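(* Let $I$ be an unmixed monomial ideal in $S=k[x_1,\dots,x_n]$, and let $\Delta$ be the simplicial complex on $[n]$ such that $\sqrt I$ is the Stanley-Reisner ideal of $\Delta$. Then the following conditions are equivalent: (i) $S/I$ is generalized Cohen-Macaulay. (ii) $\Delta_{\mathbf a}(I)$ is Buchsbaum for all $\mathbf a\in\mathbb N^n$ (or for all $\mathbf a\in\mathbb N^n$ with $a_j<\rho_j(I)$, $j=1,\dots,n$). (iii) $L_\Gamma(I)=\emptyset$ for every non-Buchsbaum subcomplex $\Gamma$ of $\Delta$ with $\mathcal F(\Gamma)\subseteq\mathcal F(\Delta)$.
   Context: $k$ is a field, $[n]=\{1,\dots,n\}$, $\mathbb N$ is the set of nonnegative integers, $\mathfrak m=(x_1,\dots,x_n)S$. An ideal $I$ is unmixed if $\dim(S/I)=\dim(S/P)$ for all $P\in\mathrm{Ass}(S/I)$. $S/I$ is generalized Cohen-Macaulay if the local cohomology module $H^i_{\mathfrak m}(S/I)$ has finite length for all $i<\dim(S/I)$. The Stanley-Reisner ideal of a simplicial complex $\Delta$ on $[n]$ is $(\prod_{i\in F}x_i : F\subseteq[n],\,F\notin\Delta)$. $\mathcal F(\Delta)$ is the set of facets (maximal faces) of $\Delta$. For $F\subseteq[n]$ let $P_F=(x_i : i\notin F)S$; the minimal primes of $I$ are the $P_F$ with $F\in\mathcal F(\Delta)$, and $I_F$ denotes the $P_F$-primary component of $I$ (so $I=\bigcap_{F\in\mathcal F(\Delta)}I_F$, since $I$ is unmixed). $\rho_j(I)$ is the maximum of the $j$-th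 coordinates of all $\mathbf b\in\mathbb N^n$ such that $\mathbf x^{\mathbf b}=\prod_i x_i^{b_i}$ is a minimal monomial generator of $I$. For $\mathbf a=(a_1,\dots,a_n)\in\mathbb N^n$, the degree complex $\Delta_{\mathbf a}(I)$ is the simplicial complex whose faces are the sets $F\subseteq[n]$ such that for every minimal monomial generator $\mathbf x^{\mathbf b}$ of $I$ there exists $i\notin F$ with $a_i<b_i$. For a subcomplex $\Gamma$ of $\Delta$ with $\mathcal F(\Gamma)\subseteq\mathcal F(\Delta)$, $$L_\Gamma(I)=\Big\{\mathbf a\in\mathbb N^n : \mathbf x^{\mathbf a}\in\bigcap_{F\in\mathcal F(\Delta)\setminus\mathcal F(\Gamma)}I_F\setminus\bigcup_{G\in\mathcal F(\Gamma)}I_G\Big\}$$ (an empty intersection being $S$). A simplicial complex $\Delta$ is Buchsbaum if its Stanley-Reisner ring over $k$ is Buchsbaum; equivalently, $\Delta$ is pure (all facets have the same dimension) and $\widetilde H_j(\mathrm{lk}_\Delta F;k)=0$ for all $F\in\Delta\setminus\{\emptyset\}$ and all $j<\dim\Delta-|F|$, where $\widetilde H_j$ is reduced homology and $\mathrm{lk}_\Delta F=\{H\in\Delta : H\cup F\in\Delta,\ H\cap F=\emptyset\}$. The void complex (no faces), which occurs as $\Delta_{\mathbf a}(I)$ when $\mathbf x^{\mathbf a}\in I$, imposes no condition, i.e. it is regarded as Buchsbaum.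
   Formalization: In the restricted form of (ii) the bound a_j < ρ_j(I) is read as a_j < max(1, ρ_j(I)), since with ρ_j(I) = 0 the literal condition is vacuous and the equivalence fails, e.g. for (x_1,x_2)∩(x_3,x_4) in k[x_1,…,x_5]. *)

(* Defs.v *)
From HB Require Import structures.
From mathcomp Require Import all_boot all_order all_algebra.
From mathcomp Require Import boolp.
From mathcomp Require Import mpoly.

Set Implicit Arguments.
Unset Strict Implicit.
Unset Printing Implicit Defensive.

Import GRing.Theory.
Local Open Scope ring_scope.

(** Subsets of a ring are Prop-valued predicates, and two ideals are identified
    when they have the same elements.  The variables are indexed by ['I_n]. *)

Section Ideals.
Variable S : comNzRingType.
Implicit Types (I J P Q : S -> Prop).

Definition is_ideal J : Prop :=
  [/\ J 0, forall f g, J f -> J g -> J (f + g)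
         & forall s f, J f -> J (s * f)].

Definition ideal_gen (G : S -> Prop) : S -> Prop := fun f =>
  exists (r : nat) (g h : 'I_r -> S),
    (forall j, G (g j)) /\ f = \sum_(j < r) h j * g j.

Definition radical J : S -> Prop := fun f => exists t : nat, J (f ^+ t).

Definition prime_ideal P : Prop :=
  [/\ is_ideal P, ~ P 1 & forall f g, P (f * g) -> P f \/ P g].

Definition primary_ideal Q : Prop :=
  [/\ is_ideal Q, ~ Q 1 & forall f g, Q (f * g) -> Q f \/ radical Q g].

(** [dim_quot_ge J d]: the ring [S/J] has Krull dimension at least [d], a chain
    of primes of [S/J] being a chain of primes of [S] that contain [J].
    It fails for every [d] when [J] is the unit ideal. *)
Definition dim_quot_ge J (d : nat) : Prop :=
  exists P : nat -> S -> Prop,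
    [/\ forall i, (i <= d)%N -> prime_ideal (P i),
        forall f, J f -> P 0%N f
      & forall i, (i < d)%N ->
          (forall f, P i f -> P i.+1 f) /\ (exists f, P i.+1 f /\ ~ P i f)].

Definition same_dim_quot I J : Prop :=
  forall d, dim_quot_ge I d <-> dim_quot_ge J d.

(** [P] is in Ass([S/I]): [P] is prime and is the annihilator of the class of
    some [f]. *)
Definition associated_prime I P : Prop :=
  prime_ideal P /\ exists f, forall g, P g <-> I (g * f).

Definition unmixed I : Prop :=
  forall P, associated_prime I P -> same_dim_quot I P.

Definition minimal_primary_decomposition I (r : nat) (D : 'I_r -> S -> Prop) :=
  [/\ forall j, primary_ideal (D j),
      forall f, I f <-> (forall j, D j f),
      forall i j, (forall f, radical (D i) f <-> radical (D j) f) -> i = j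
    & forall i, exists f, (forall j, j != i -> D j f) /\ ~ D i f].

(** The [P]-primary component of [I].  It does not depend on the decomposition
    when [P] is a minimal prime of [I]. *)
Definition primary_component I P : S -> Prop := fun f =>
  exists (r : nat) (D : 'I_r -> S -> Prop) (j : 'I_r),
    [/\ minimal_primary_decomposition I D,
        forall g, radical (D j) g <-> P g
      & D j f].

(** For submodules [B], [Z] of [V] with [B] contained in [Z], the [S]-module
    [Z/B] has finite length: the strict chains of submodules of [V] between [B]
    and [Z] have bounded length.  Here [V] is an abelian group on which [S] acts
    through [act]. *)
Definition is_submodule (V : zmodType) (act : S -> V -> V) (N : V -> Prop) :=
  [/\ N 0, forall u v, N u -> N v -> N (u + v)
         & forall s u, N u -> N (act s u)].

Definition subquot_finite_length (V : zmodType) (act : S -> V -> V)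
    (B Z : V -> Prop) : Prop :=
  exists b : nat, forall (r : nat) (N : nat -> V -> Prop),
    (forall i, (i <= r)%N ->
      [/\ is_submodule act (N i), forall v, B v -> N i v
        & forall v, N i v -> Z v]) ->
    (forall i, (i < r)%N ->
      (forall v, N i v -> N i.+1 v) /\ (exists v, N i.+1 v /\ ~ N i v)) ->
    (r <= b)%N.

End Ideals.

(** The incidence sign of [v] with respect to [A], for the natural order on the
    vertices: (-1)^#{w in A : w < v}. *)
Definition inc_sign (R : nzRingType) (n : nat) (v : 'I_n) (A : {set 'I_n}) : R :=
  (-1) ^+ #|[set w in A | (w < v)%N]|.

(** Local cohomology of [S/I] with support in (x_1, ..., x_n), as the cohomology
    of the Cech complex
      C^i = direct sum over #|F| = i of (S/I)_{x_F},
    where x_F is the product of the x_j with j in F.  Since localization is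
    exact, (S/I)_{x_F} = S_{x_F} / I S_{x_F}, and the two terms of this quotient
    are realized inside the fraction field of [S].  A cochain is thus a family
    of fractions indexed by all subsets F, zero unless #|F| = i. *)
Section Cech.
Variables (k : fieldType) (n : nat).
Local Notation S := {mpoly k[n]}.
Local Notation K := {fraction {mpoly k[n]}}.
Local Notation tofrac := (@FracField.tofrac {mpoly k[n]}).
Implicit Types (I J : S -> Prop) (c : {ffun {set 'I_n} -> K}).

Definition mono_of_set (F : {set 'I_n}) : S := \prod_(i in F) 'X_i.

(** The extension J S_{x_F} of the ideal [J]. *)
Definition loc_ideal J (F : {set 'I_n}) : K -> Prop := fun q =>
  exists (f : S) (t : nat), J f /\ q = tofrac f / tofrac (mono_of_set F ^+ t).

Definition cech_cochain J (i : nat) c : Prop :=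
  forall F : {set 'I_n}, if #|F| == i then loc_ideal J F (c F) else c F = 0.

Definition cech_diff c : {ffun {set 'I_n} -> K} :=
  [ffun G : {set 'I_n} => \sum_(v in G) inc_sign K v G * c (G :\ v)].

Definition cech_act (s : S) c : {ffun {set 'I_n} -> K} :=
  [ffun F => tofrac s * c F].

(** Cocycles and coboundaries of the complex for [S/I], as families over the
    S_{x_F}: the relations hold modulo I S_{x_F}. *)
Definition cech_cocycle I (i : nat) c : Prop :=
  cech_cochain (fun _ => True) i c /\ cech_cochain I i.+1 (cech_diff c).

Definition cech_coboundary I (i : nat) c : Prop :=
  if i is j.+1 then
    exists b, cech_cochain (fun _ => True) j b /\
              cech_cochain I i (c - cech_diff b)
  else cech_cochain I i c.

Definition local_cohomology_finite_length I (i : nat) : Prop :=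
  subquot_finite_length cech_act (cech_coboundary I i) (cech_cocycle I i).

(** [dim_quot_ge I i.+1] says that i < dim(S/I). *)
Definition generalized_CM I : Prop :=
  forall i, dim_quot_ge I i.+1 -> local_cohomology_finite_length I i.

End Cech.

(** A simplicial complex is the set of its faces; the void complex [set0] and
    the complex whose only face is the empty set are distinct. *)
Section Complexes.
Variables (k : fieldType) (n : nat).
Implicit Types (Delta Gamma : {set {set 'I_n}}) (F G : {set 'I_n}).

Definition simplicial_complex Delta : Prop :=
  forall F G, F \in Delta -> G \subset F -> G \in Delta.

Definition facets Delta : {set {set 'I_n}} :=
  [set F in Delta | [forall G in Delta, (F \subset G) ==> (G == F)]].

Definition link Delta F : {set {set 'I_n}} :=
  [set H : {set 'I_n} | [&& H \in Delta, H :|: F \in Delta & H :&: F == set0]].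

Definition pure_complex Delta : Prop :=
  forall F G, F \in facets Delta -> G \in facets Delta -> #|F| = #|G|.

(** Augmented oriented chains over [k], graded by the number [m] of vertices of
    the faces, i.e. in homological degree m - 1. *)
Definition simplicial_chain Delta (m : nat) (c : {ffun {set 'I_n} -> k}) :=
  forall F, c F != 0 -> F \in Delta /\ #|F| = m.

Definition boundary (c : {ffun {set 'I_n} -> k}) : {ffun {set 'I_n} -> k} :=
  [ffun G : {set 'I_n} => \sum_(v | v \notin G) inc_sign k v G * c (v |: G)].

(** The reduced homology of [Delta] over [k] vanishes in degree m - 1. *)
Definition reduced_homology_zero Delta (m : nat) : Prop :=
  forall c, simplicial_chain Delta m c -> boundary c = 0 ->
    exists d, simplicial_chain Delta m.+1 d /\ c = boundary d.

(** 1 + the dimension. *)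
Definition dim_succ Delta : nat := \max_(F in Delta) #|F|.

(** With j = m - 1, the bound on m is j < dim Delta - #|F|.  The void complex
    satisfies the condition. *)
Definition buchsbaum Delta : Prop :=
  pure_complex Delta /\
  forall F, F \in Delta -> F != set0 ->
    forall m, (m + #|F| < dim_succ Delta)%N ->
      reduced_homology_zero (link Delta F) m.

End Complexes.

Section MonomialIdeals.
Variables (k : fieldType) (n : nat).
Local Notation S := {mpoly k[n]}.
Implicit Types (I : S -> Prop) (Delta Gamma : {set {set 'I_n}}).

Definition monomial_ideal I : Prop :=
  exists B : 'X_{1..n} -> Prop,
    forall f, I f <-> ideal_gen (fun g : S => exists2 b, B b & g = 'X_[b]) f.

Definition stanley_reisner Delta : S -> Prop :=
  ideal_gen (fun g : S =>
    exists2 F : {set 'I_n}, F \notin Delta & g = mono_of_set k F).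

Definition face_prime (F : {set 'I_n}) : S -> Prop :=
  ideal_gen (fun g : S => exists2 i : 'I_n, i \notin F & g = 'X_i).

(** The order on exponents is the componentwise one. *)
Definition min_generator I (b : 'X_{1..n}) : Prop :=
  I 'X_[b] /\ forall c : 'X_{1..n}, (c <= b)%MM -> I 'X_[c] -> c = b.

Definition is_rho I (j : 'I_n) (r : nat) : Prop :=
  (exists2 b : 'X_{1..n}, min_generator I b & b j = r) /\
  forall b : 'X_{1..n}, min_generator I b -> (b j <= r)%N.

(** The maximum over the empty set, which occurs only for the zero ideal, is 0.
    Also [rho I j = 0] when x_j divides no minimal generator.  The condition
    a_j < rho_j(I) would then exclude every [a], although no face condition
    depends on a_j; [maxn 1 (rho I j)] as the bound keeps a_j = 0. *)
Definition rho I (j : 'I_n) : nat :=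
  if pselect (exists r, is_rho I j r) is left h then projT1 (cid h) else 0%N.

Definition degree_complex I (a : 'X_{1..n}) : {set {set 'I_n}} :=
  [set F : {set 'I_n} | `[< forall b : 'X_{1..n}, min_generator I b ->
                              exists2 i, i \notin F & (a i < b i)%N >]].

Definition in_L Delta I Gamma (a : 'X_{1..n}) : Prop :=
  (forall F, F \in facets Delta :\: facets Gamma ->
     primary_component I (face_prime F) 'X_[a]) /\
  (forall G, G \in facets Gamma ->
     ~ primary_component I (face_prime G) 'X_[a]).

End MonomialIdeals.

(* Main.v *)
Require Import Defs.
From HB Require Import structures.
From mathcomp Require Import all_boot all_order all_algebra.
From mathcomp Require Import boolp.
From mathcomp Require Import mpoly.
From mathcomp Require Import ring.

(** Write [Del a] for [degree_complex I a] and [d] for the dimension of [S/I].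

The Cech complex of [S/I] is graded by the integer vectors.  In degree [b], let
[F] be the set of the [i] with [b i < 0] and let [a] be the positive part of
[b].  The localization of [S/I] at [x_H] is nonzero in degree [b] exactly when
[F] is contained in [H] and [H] is a face of [Del a], and is then a line.  The
degree [b] part of the complex is therefore the cochain complex of the faces of
[Del a] that contain [F], that is, up to signs and a shift by [#|F|], of the link
of [F] (Takayama's formula).  Here it is [cech_ideal_slices], and [cohom_zero]
expresses the vanishing of the cohomology of such a part.

If for some [j] outside [F] the exponent [a j] is at least the exponent of
[x_j] in each minimal generator, then the faces in question form a cone with
apex [j], and the part of degree [b] is acyclic.  By Dickson's lemma only
finitely many degrees with [F] empty escape this.  If [F] is nonempty, then
nothing changes when the negative coordinates of [b] decrease further, so one
nonzero part produces infinitely many.  Hence the [i]-th local cohomology has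
finite length if and only if its parts of degree [b] vanish for all [b] with
[F] nonempty ([finite_lengthP]).

Over a field the cohomology of a link vanishes exactly when its homology does
([homology_zero_cohom]), so these conditions for all [i < d] say the same as the
vanishing condition in the definition of Buchsbaum complexes for all the
[Del a], provided that each [Del a] is void or pure of dimension [d - 1].  This
is where unmixedness enters: for a facet [F] of [Del a] the prime [P_F] is
associated to [I] ([facet_associated]), and [S/P_F] has dimension [#|F|]
([dim_face_primeE]), so all facets of all the [Del a] have [d] elements.  They
are in particular facets of [Del 0 = Delta].  The upper bound for the dimension
of [S/P_F] comes from counting monomials: a chain of [r] strict inclusions of
primes yields [r] algebraically independent elements.

For the bounded range of exponents, the cone argument disposes of the vectors
[a] with [rho I j <= a j] for some [j] outside [F], and the coordinates in [F]
do not matter.  Finally, for a facet [F] of [Delta] the monomial [x^a] lies in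
the [P_F]-primary component of [I] if and only if [F] is not a face of [Del a]
([primary_componentE]).  So [a] belongs to the set L of [Gamma] exactly when
[Gamma = Del a] ([in_L_degree_complex]), and the third condition is the first
one read for the complexes that occur as some [Del a]. *)

Set Implicit Arguments.
Unset Strict Implicit.
Unset Printing Implicit Defensive.

Import GRing.Theory.
Local Open Scope ring_scope.

(** * Linear algebra over a field *)

Lemma sum_enum_val (V : nmodType) (W : finType) (f : W -> V) :
  \sum_x f x = \sum_(i < #|W|) f (enum_val i).
Proof.
rewrite (reindex_onto enum_val enum_rank) => [|x _]; last exact: enum_rankK.
by apply: eq_bigl => i; rewrite enum_valK eqxx.
Qed.

Lemma exists_linear_relation (k : fieldType) (X Y : finType) (a : X -> Y -> k) :
  (#|Y| < #|X|)%N ->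
  exists l : X -> k, (exists x, l x != 0) /\ forall y, \sum_x l x * a x y = 0.
Proof.
move=> ltYX.
pose A : 'M_(#|X|, #|Y|) := \matrix_(i, j) a (enum_val i) (enum_val j).
have /rowV0Pn[v /sub_kermxP vA v0] : kermx A != 0.
  by rewrite -mxrank_eq0 mxrank_ker subn_eq0 -ltnNge (leq_ltn_trans (rank_leq_col _)).
exists (fun x => v 0 (enum_rank x)); split.
  have /rV0Pn[i vi] := v0.
  by exists (enum_val i); rewrite enum_valK.
move=> y; rewrite sum_enum_val; have /rowP/(_ (enum_rank y)) := vA.
rewrite !mxE => vAy; apply: etrans vAy.
by apply: eq_bigr => i _; rewrite !mxE enum_valK enum_rankK.
Qed.

(** Exactness passes to the transposed complex.  Here [Q], [P], [R] index three
    consecutive chain groups and [del] is the matrix of the differentials.  If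
    [u] were outside the column space of the block [P] by [R], some [c] killed
    by this block would pair nontrivially with [u]; but by exactness [c] is a
    combination of the rows in [Q], all of which are orthogonal to [u]. *)
Lemma exact_dual (k : fieldType) (W : finType) (del : W -> W -> k)
    (P Q R : pred W) :
  (forall c : W -> k, (forall g, ~~ P g -> c g = 0) ->
     (forall h, R h -> \sum_g c g * del g h = 0) ->
     exists d : W -> k, (forall g, ~~ Q g -> d g = 0) /\
       forall g, P g -> c g = \sum_h d h * del h g) ->
  forall u : W -> k, (forall g, ~~ P g -> u g = 0) ->
     (forall h, Q h -> \sum_g del h g * u g = 0) ->
     exists w : W -> k, (forall g, ~~ R g -> w g = 0) /\
       forall g, P g -> u g = \sum_h del g h * w h.
Proof.
move=> ex u uP uQ.
pose B : 'M_(#|W|) := \matrix_(i, j)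
  (if P (enum_val i) && R (enum_val j) then del (enum_val i) (enum_val j) else 0).
pose uv : 'rV_(#|W|) := \row_i u (enum_val i).
have [K [BK uK]] : exists K : 'M_(#|W|), B^T *m K = 0 /\ ((uv <= B^T)%MS = (uv *m K == 0)).
  by exists (cokermx B^T); rewrite submxE mulmx_coker.
have /submxP[D uD] : (uv <= B^T)%MS.
  rewrite uK; apply/eqP/rowP=> j; rewrite !mxE.
  pose c g := if P g then K (enum_rank g) j else 0.
  have [||d [dQ dE]] := ex c.
  - by move=> g /negPf; rewrite /c => ->.
  - move=> h Rh; rewrite sum_enum_val.
    have /matrixP/(_ (enum_rank h) j) := BK; rewrite !mxE => Bz; apply: etrans Bz.
    apply: eq_bigr => i _; rewrite !mxE /c enum_rankK Rh andbT enum_valK.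
    by case: ifP => _; rewrite ?mul0r // mulrC.
  have -> : \sum_j0 uv 0 j0 * K j0 j = \sum_g u g * c g.
    rewrite [RHS]sum_enum_val; apply: eq_bigr => i _; rewrite !mxE /c enum_valK.
    by case: ifP => // /negbT/uP ->; rewrite !mul0r.
  have -> : \sum_g u g * c g = \sum_g \sum_h d h * (del h g * u g).
    apply: eq_bigr => g _; case: (boolP (P g)) => [Pg|/uP ->].
      by rewrite dE // mulr_sumr; apply: eq_bigr => h _; rewrite mulrC mulrA.
    by rewrite mul0r big1 // => h _; rewrite !mulr0.
  rewrite exchange_big big1 // => h _; rewrite -mulr_sumr.
  by case: (boolP (Q h)) => [/uQ ->|/dQ ->]; rewrite ?mulr0 ?mul0r.
exists (fun h => if R h then D 0 (enum_rank h) else 0); split.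
  by move=> g /negPf ->.
move=> g Pg; have /rowP/(_ (enum_rank g)) := uD; rewrite !mxE enum_rankK => ->.
rewrite [RHS]sum_enum_val; apply: eq_bigr => i _;
  rewrite !mxE enum_rankK Pg enum_valK /= mulrC.
by case: ifP => _; rewrite ?mulr0 ?mul0r.
Qed.

(** * Ideals and radicals *)

Section IdealLemmas.
Variable S : comNzRingType.
Implicit Types (J : S -> Prop).

Lemma ideal_opp J f : is_ideal J -> J f -> J (- f).
Proof. by case=> _ _ mJ /(mJ (-1)); rewrite mulN1r. Qed.

Lemma ideal_sub J f g : is_ideal J -> J f -> J g -> J (f - g).
Proof. by move=> iJ Jf Jg; case: (iJ) => _ aJ _; apply: aJ => //; exact: ideal_opp. Qed.

Lemma ideal_sum J (T : Type) (r : seq T) (Q : pred T) (f : T -> S) :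
  is_ideal J -> (forall x, Q x -> J (f x)) -> J (\sum_(x <- r | Q x) f x).
Proof. by case=> J0 aJ _ Jf; elim/big_ind: _. Qed.

Lemma ideal_mulr J f g : is_ideal J -> J f -> J (f * g).
Proof. by case=> _ _ mJ Jf; rewrite mulrC; exact: mJ. Qed.

Lemma ideal_exp J f m t : is_ideal J -> (m <= t)%N -> J (f ^+ m) -> J (f ^+ t).
Proof. by move=> iJ le Jf; rewrite -(subnKC le) exprD; exact: ideal_mulr. Qed.

Lemma radical_ideal J : is_ideal J -> is_ideal (radical J).
Proof.
move=> iJ; split.
- by exists 1%N; rewrite expr1; case: iJ.
- move=> f g [s Js] [t Jt]; exists (s + t)%N.
  rewrite exprDn; apply: ideal_sum => // -[i /= ilt] _.
  rewrite -mulr_natr; apply: ideal_mulr => //.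
  have [sle|lts] := leqP s (s + t - i).
    by apply: ideal_mulr => //; exact: ideal_exp Js.
  case: (iJ) => _ _; apply; apply: ideal_exp Jt => //.
  by rewrite leqNgt; apply/negP => it; move: lts;
    rewrite -addnBA ?(ltnW it) // ltnNge leq_addr.
- by move=> s f [t Jt]; exists t; rewrite exprMn; case: iJ => _ _; apply.
Qed.

Lemma ideal_gen_sub (G J : S -> Prop) : is_ideal J -> (forall g, G g -> J g) ->
  forall f, ideal_gen G f -> J f.
Proof.
move=> iJ GJ f [r [g [h [Gg ->]]]]; apply: ideal_sum => // j _.
by case: (iJ) => _ _; apply; exact: GJ.
Qed.

Lemma prime_exp (P : S -> Prop) f t : prime_ideal P -> P (f ^+ t) -> P f.
Proof.
case=> iP P1 Pm; elim: t => [|t IH]; first by rewrite expr0.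
by rewrite exprS => /Pm[].
Qed.

Lemma ideal_gen_eq (G G' : S -> Prop) f : (forall g, G g <-> G' g) ->
  ideal_gen G f <-> ideal_gen G' f.
Proof.
by move=> GG; split=> -[r [g [h [Gg ->]]]]; exists r, g, h; split=> // j; apply/GG.
Qed.
End IdealLemmas.

(** * Monomial ideals and their primary decomposition *)

Section MonIdeal.
Variables (k : fieldType) (n : nat).
Local Notation S := {mpoly k[n]}.
Implicit Types (M B : 'X_{1..n} -> Prop) (f g : S) (F : {set 'I_n}).

(** Monomial ideals are handled through the set of their exponents, which is
    closed upwards; [mon_ideal M] is the ideal spanned by the monomials whose
    exponents are in [M]. *)
Definition upset M := forall b c : 'X_{1..n}, M b -> (b <= c)%MM -> M c.

Definition mon_ideal M : S -> Prop := fun f => forall b, b \in msupp f -> M b.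

Lemma mon_idealX M b : mon_ideal M 'X_[b] <-> M b.
Proof.
split; first by apply; rewrite msuppX inE.
by move=> Mb c; rewrite msuppX inE => /eqP ->.
Qed.

Lemma mon_ideal_ideal M : upset M -> is_ideal (mon_ideal M).
Proof.
move=> uM; split; first by move=> b; rewrite msupp0.
  by move=> f g Mf Mg b /msuppD_le; rewrite mem_cat => /orP[]; [exact: Mf|exact: Mg].
move=> s f Mf b /msuppM_le/allpairsP[[x y] /= [_ /Mf My ->]].
exact: uM My (lem_addl _ _).
Qed.

Lemma upset_gen B : upset (fun b => exists2 c, B c & (c <= b)%MM).
Proof. by move=> b c [d Bd db] bc; exists d => //; exact: lepm_trans bc. Qed.

(** In particular a polynomial of a monomial ideal has all its monomials there. *)
Lemma ideal_gen_mon B f :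
  ideal_gen (fun g : S => exists2 b, B b & g = 'X_[b]) f <->
  mon_ideal (fun b => exists2 c, B c & (c <= b)%MM) f.
Proof.
split.
  apply: ideal_gen_sub; first exact/mon_ideal_ideal/upset_gen.
  by move=> _ [b Bb ->]; apply/mon_idealX; exists b => //; exact: lepm_refl.
move=> Mf; pose c b : 'X_{1..n} :=
  if pselect (exists2 c, B c & (c <= b)%MM) is left h then s2val (cid2 h) else b.
have cP b : b \in msupp f -> B (c b) /\ (c b <= b)%MM.
  by rewrite /c => /Mf; case: pselect => // h _; case: (cid2 h).
pose b (j : 'I_(size (msupp f))) := nth 0%MM (msupp f) j.
have bP j : b j \in msupp f by exact: mem_nth.
exists (size (msupp f)), (fun j => 'X_[c (b j)]),
  (fun j => f@_(b j) *: 'X_[(b j - c (b j))%MM]); split.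
  by move=> j; exists (c (b j)) => //; case: (cP _ (bP j)).
rewrite {1}[f]mpolyE (big_nth 0%MM) big_mkord; apply: eq_bigr => j _.
rewrite -scalerAl -mpolyXD submK //.
by case: (cP _ (bP j)).
Qed.

Lemma monomial_idealP (I : S -> Prop) : monomial_ideal I ->
  upset (fun b => I 'X_[b]) /\ forall f, I f <-> mon_ideal (fun b => I 'X_[b]) f.
Proof.
case=> B IB.
have IE f : I f <-> mon_ideal (fun b => exists2 c, B c & (c <= b)%MM) f.
  by rewrite IB ideal_gen_mon.
have XE b : I 'X_[b] <-> exists2 c, B c & (c <= b)%MM by rewrite IE mon_idealX.
split; first by move=> b c /XE Ib bc; apply/XE; apply: upset_gen Ib bc.
move=> f; rewrite IE; split=> Mf b /Mf; by move/XE.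
Qed.

Definition var_outside F (b : 'X_{1..n}) := exists2 i, i \notin F & (0 < b i)%N.

Lemma var_outside_up F : upset (var_outside F).
Proof.
move=> b c [i iF bi] /mnm_lepP/(_ i) le; exists i => //; exact: leq_trans le.
Qed.

Lemma face_primeE F f : face_prime F f <-> mon_ideal (var_outside F) f.
Proof.
have -> : face_prime F f <-> ideal_gen (fun g : S => exists2 b : 'X_{1..n},
    (exists2 i, i \notin F & b = U_(i)%MM) & g = 'X_[b]) f.
  apply: ideal_gen_eq => g; split.
    by case=> i iF ->; exists U_(i)%MM => //; exists i.
  by case=> b [i iF ->] ->; exists i.
rewrite ideal_gen_mon; split=> Mf b /Mf.
  by case=> c [i iF ->]; rewrite lep1mP -lt0n => bi; exists i.
by case=> i iF bi; exists U_(i)%MM; [exists i|rewrite lep1mP -lt0n].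
Qed.

Lemma face_prime_ideal F : is_ideal (@face_prime k n F).
Proof.
have [a b c] := mon_ideal_ideal (@var_outside_up F).
split; first exact/face_primeE.
  by move=> f g /face_primeE Pf /face_primeE Pg; apply/face_primeE; exact: b.
by move=> s f /face_primeE Pf; apply/face_primeE; exact: c.
Qed.

(** The exponent of [x_F ^+ t]. *)
Definition set_expo F (t : nat) : 'X_{1..n} :=
  [multinom (if i \in F then t else 0)%N | i < n].

Lemma set_expoE F t i : set_expo F t i = if i \in F then t else 0%N.
Proof. by rewrite mnmE. Qed.

Lemma mono_of_setE F : mono_of_set k F = 'X_[set_expo F 1].
Proof.
rewrite /mono_of_set mprodXE; congr 'X_[_]; apply/mnmP => i.
rewrite mnm_sumE set_expoE; case: ifP => iF.
  rewrite (bigD1 i) //= mnm1E eqxx big1 // => j /andP[_ ji].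
  by rewrite mnm1E (negPf ji).
rewrite big1 // => j jF; rewrite mnm1E; case: eqP => // ji; by rewrite -ji jF in iF.
Qed.

Lemma mono_of_setX F t : mono_of_set k F ^+ t = 'X_[set_expo F t].
Proof.
rewrite mono_of_setE mpolyXn; congr 'X_[_]; apply/mnmP => i.
by rewrite mulmnE !set_expoE; case: ifP; rewrite ?mul1n ?mul0n.
Qed.

Lemma stanley_reisnerX (Delta : {set {set 'I_n}}) b :
  stanley_reisner Delta ('X_[b] : S) <->
  exists2 F : {set 'I_n}, F \notin Delta & (set_expo F 1 <= b)%MM.
Proof.
have -> : stanley_reisner Delta ('X_[b] : S) <-> ideal_gen (fun g : S =>
  exists2 b : 'X_{1..n},
    (exists2 F : {set 'I_n}, F \notin Delta & b = set_expo F 1) & g = 'X_[b]) 'X_[b].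
  apply: ideal_gen_eq => g; split.
    by case=> F FD ->; exists (set_expo F 1); [exists F|exact: mono_of_setE].
  by case=> c [F FD ->] ->; exists F => //; rewrite mono_of_setE.
rewrite ideal_gen_mon mon_idealX; split.
  by case=> c [F FD ->] le; exists F.
by case=> F FD le; exists (set_expo F 1) => //; exists F.
Qed.

Definition poly_in F g := forall b, b \in msupp g -> forall i, i \notin F -> b i = 0%N.

Lemma poly_in_exp F g t : poly_in F g -> poly_in F (g ^+ t).
Proof.
move=> Fg; elim: t => [|t IH].
  by rewrite expr0 => b; rewrite msupp1 inE => /eqP -> i _; rewrite mnm0E.
rewrite exprS => b /msuppM_le/allpairsP[[x y] /= [xg yg ->]] i iF.
by rewrite mnmDE (Fg x) // (IH y).
Qed.

Definition mono_part (Q : pred 'X_{1..n}) f : S :=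
  \sum_(b <- msupp f | Q b) f@_b *: 'X_[b].

Lemma mcoeff_mono_part Q f b : (mono_part Q f)@_b = if Q b then f@_b else 0.
Proof.
rewrite /mono_part raddf_sum /=.
under eq_bigr do rewrite mcoeffZ mcoeffX.
case: (boolP (b \in msupp f)) => bf; last first.
  rewrite (memN_msupp_eq0 bf) if_same big1_seq // => c /andP[_ cf].
  by case: eqP => [cb|]; [rewrite cb (negPf bf) in cf|rewrite mulr0].
rewrite big_mkcond (bigD1_seq b) ?msupp_uniq //= eqxx mulr1 big1 ?addr0 // => c /negPf cb.
by rewrite cb mulr0 if_same.
Qed.

Lemma mem_msupp_mono_part Q f b : (b \in msupp (mono_part Q f)) = Q b && (b \in msupp f).
Proof. by rewrite !mcoeff_msupp mcoeff_mono_part; case: ifP => //=; rewrite eqxx. Qed.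

Lemma mem_msupp_mono_partC Q f b : (b \in msupp (f - mono_part Q f)) =
  ~~ Q b && (b \in msupp f).
Proof.
by rewrite !mcoeff_msupp mcoeffB mcoeff_mono_part; case: ifP => /=;
  rewrite ?subrr ?eqxx // subr0.
Qed.

(** Remove from [f] its terms that lie in the ideal.  The leading monomial of the
    product of the rest with [g] is the product of the leading monomials; it is
    in the ideal, and the factor coming from [g], having only variables in [F],
    can be cancelled. *)
Lemma mon_ideal_cancel F M f g : upset M ->
  (forall b c : 'X_{1..n}, (forall i, i \notin F -> c i = 0%N) -> M (b + c)%MM -> M b) ->
  g != 0 -> poly_in F g -> mon_ideal M (f * g) -> mon_ideal M f.
Proof.
move=> uM satM g0 Fg Mfg.
pose f1 := mono_part (fun b => ~~ `[< M b >]) f.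
have Mf0 : mon_ideal M (f - f1).
  by move=> b; rewrite mem_msupp_mono_partC negbK => /andP[/asboolP].
have iM := mon_ideal_ideal uM.
have Mf1g : mon_ideal M (f1 * g).
  have -> : f1 * g = f * g - (f - f1) * g by rewrite mulrBl opprB addrC subrK.
  exact: (ideal_sub iM Mfg (ideal_mulr _ iM Mf0)).
have [f10|f10] := eqVneq f1 0; first by move: Mf0; rewrite f10 subr0.
have /Mf1g : mlead (f1 * g) \in msupp (f1 * g).
  by rewrite mlead_supp // mulf_neq0.
rewrite mleadM // => /(satM _ _ (Fg _ (mlead_supp g0))) Ml.
have := mlead_supp f10; rewrite mem_msupp_mono_part => /andP[/asboolP]; by case.
Qed.

Definition vars_in F (b : 'X_{1..n}) := [forall i, (i \notin F) ==> (b i == 0%N)].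

Lemma vars_inN F b : ~~ vars_in F b -> var_outside F b.
Proof.
rewrite negb_forall => /existsP[i]; rewrite negb_imply -lt0n => /andP[iF bi].
by exists i.
Qed.

Lemma vars_inP F b : vars_in F b -> forall i, i \notin F -> b i = 0%N.
Proof. by move=> /forallP h i iF; apply/eqP; exact: (implyP (h i)). Qed.

Lemma poly_in_mono_part F f : poly_in F (mono_part (vars_in F) f).
Proof. by move=> b; rewrite mem_msupp_mono_part => /andP[/vars_inP]. Qed.

Lemma face_prime_mono_part F f : face_prime F (f - mono_part (vars_in F) f).
Proof. by apply/face_primeE => b; rewrite mem_msupp_mono_partC => /andP[/vars_inN]. Qed.

(** Modulo the face prime a polynomial agrees with its part in the variables of
    [F], which can be cancelled when it is nonzero. *)
Lemma face_prime_prime F : prime_ideal (@face_prime k n F).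
Proof.
have iP := face_prime_ideal F.
split=> //.
  by move/face_primeE/(_ 0%MM); rewrite msupp1 inE eqxx => /(_ isT)[i _]; rewrite mnm0E.
move=> f g Pfg; have Pq := face_prime_mono_part F g.
have [g0|g0] := eqVneq (mono_part (vars_in F) g) 0.
  by right; move: Pq; rewrite g0 subr0.
left; apply/face_primeE.
apply: (@mon_ideal_cancel F _ f (mono_part (vars_in F) g)) => //;
  first exact: var_outside_up.
- move=> b c c0 [i iF]; rewrite mnmDE c0 // addn0; by exists i.
- exact: poly_in_mono_part.
apply/face_primeE; have -> : f * mono_part (vars_in F) g =
  f * g - f * (g - mono_part (vars_in F) g).
  by rewrite mulrBr opprB addrC subrK.
by apply: ideal_sub => //; case: iP => _ _; apply.
Qed.

Lemma face_prime_sub F (J : S -> Prop) : is_ideal J ->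
  (forall i, i \notin F -> J 'X_i) -> forall f, face_prime F f -> J f.
Proof. by move=> iJ XJ; apply: ideal_gen_sub => // _ [i iF ->]; exact: XJ. Qed.

(** Let [f * g] be in the ideal and [g] outside the face prime, and write [q] for
    the terms of [g] that involve a variable outside [F].  Some power [q ^+ t]
    is in the ideal, and [(g - q) ^+ t - (- q) ^+ t] is a multiple of [g], so
    [f * (g - q) ^+ t] is in the ideal; but [g - q] is a nonzero polynomial in
    the variables of [F], and can be cancelled. *)
Lemma mon_primary F M : upset M -> ~ M 0%MM ->
  (forall b c : 'X_{1..n}, (forall i, i \notin F -> c i = 0%N) -> M (b + c)%MM -> M b) ->
  (forall i, i \notin F -> exists t, M (U_(i) *+ t)%MM) ->
  primary_ideal (mon_ideal M) /\
  forall f, radical (mon_ideal M) f <-> face_prime F f.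
Proof.
move=> uM M0 satM powM; have iM := mon_ideal_ideal uM.
have MF b : M b -> var_outside F b.
  move=> Mb; apply: vars_inN; apply/negP => /vars_inP b0; apply: M0.
  by apply: (satM _ b) => //; rewrite add0m.
have radE f : radical (mon_ideal M) f <-> face_prime F f.
  split=> [[t Mft]|].
    apply: prime_exp (face_prime_prime F) _ => //.
    by apply/face_primeE => b /Mft/MF; exact.
  apply: face_prime_sub; first exact: radical_ideal.
  by move=> i /powM[t Mt]; exists t; rewrite mpolyXn; apply/mon_idealX.
split=> //; split=> //.
  by move=> M1; apply/M0/mon_idealX; rewrite mpolyX0.
move=> f g Mfg.
have [Pg|nPg] := pselect (face_prime F g); [by right; apply/radE|left].
pose g0 := mono_part (vars_in F) g; pose q := g - g0.
have [t Mq] : radical (mon_ideal M) q by apply/radE; exact: face_prime_mono_part.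
have g00 : g0 != 0.
  by apply/eqP => e; apply: nPg; have := face_prime_mono_part F g; rewrite -/g0 e subr0.
apply: (@mon_ideal_cancel F _ f (g0 ^+ t)) => //.
- by rewrite expf_neq0.
- exact/poly_in_exp/poly_in_mono_part.
have M1 : mon_ideal M (f * (g0 ^+ t - (- q) ^+ t)).
  rewrite subrXX opprK /q addrCA subrr addr0 mulrA.
  exact: ideal_mulr iM Mfg.
have M2 : mon_ideal M (f * (- q) ^+ t).
  by rewrite exprNn; case: iM => _ _ mM; do 2![apply: (mM)].
rewrite -[g0 ^+ t](subrK ((- q) ^+ t)) mulrDr.
by case: iM => _ aM _; exact: aM M1 M2.
Qed.

End MonIdeal.

Arguments face_prime_prime {k n} F.
Arguments face_prime_ideal {k n} F.

(** * Dimension of the coordinate rings of the faces *)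

Section Krull.
Variables (k : fieldType) (n : nat).
Local Notation S := {mpoly k[n]}.
Implicit Types (F : {set 'I_n}).

(** The elements [f i], one from each step of a chain of primes, are
    algebraically independent modulo the first prime.  In a relation modulo
    [P j], divide by the least power of [f j] that occurs, which is possible as
    [f j] is outside the prime [P j]; modulo [P j.+1] the terms with a higher
    power of [f j] disappear.  After all the steps one nonzero coefficient
    would be left, and it would lie in the last prime. *)
Lemma chain_alg_indep (d : nat) (P : nat -> S -> Prop) (f : 'I_d -> S) (T : nat)
    (l : {ffun 'I_d -> 'I_T} -> k) :
  (forall i, (i <= d)%N -> prime_ideal (P i)) ->
  (forall i : 'I_d, [/\ forall g, P i g -> P i.+1 g, P i.+1 (f i) & ~ P i (f i)]) ->
  P 0%N (\sum_e l e *: \prod_i f i ^+ e i) -> forall e, l e = 0.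
Proof.
move=> pP fP P0 e0; apply/eqP; apply: contraT => le0; exfalso.
pose mon j (e : {ffun 'I_d -> 'I_T}) := \prod_(i < d | (j <= i)%N) f i ^+ e i.
have step j : (j <= d)%N -> exists A : {set {ffun 'I_d -> 'I_T}},
  [/\ A != set0, forall e, e \in A -> l e != 0,
      forall e e' (i : 'I_d), e \in A -> e' \in A -> (i < j)%N -> e i = e' i
    & P j (\sum_(e in A) l e *: mon j e)].
  elim: j => [|j IH] jd.
    exists [set e | l e != 0]; split.
    - by apply/set0Pn; exists e0; rewrite inE.
    - by move=> e; rewrite inE.
    - by [].
    rewrite (_ : \sum_(e in _) _ = \sum_e l e *: \prod_i f i ^+ e i) //.
    rewrite big_mkcond; apply: eq_bigr => e _; rewrite inE.
    by case: eqVneq => [->|_]; rewrite ?scale0r.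
  have [A [/set0Pn[e1 e1A] lA eqA PA]] := IH (ltnW jd).
  pose oj := Ordinal jd; have [Pj1 Pf nPf] := fP oj.
  have [iP P1 Pm] := pP _ (ltnW jd); have iP1 : is_ideal (P j.+1) by case: (pP _ jd).
  pose em := [arg min_(e < e1 in A) e oj].
  have [emA emin] : em \in A /\ forall e, e \in A -> (em oj <= e oj)%N.
    by rewrite /em; case: arg_minnP => // e eA emin.
  have monE e : e \in A -> l e *: mon j e =
    f oj ^+ em oj * (f oj ^+ (e oj - em oj) * (l e *: mon j.+1 e)).
    move=> eA; rewrite mulrA -exprD subnKC ?emin // -scalerAr; congr (_ *: _).
    rewrite /mon (bigD1 oj) //=; congr (_ * _); apply: eq_bigl => i.
    by rewrite [RHS]ltn_neqAle andbC -val_eqE eq_sym.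
  have PQ : P j (\sum_(e in A) f oj ^+ (e oj - em oj) * (l e *: mon j.+1 e)).
    move: PA; rewrite (eq_bigr _ monE) -mulr_sumr => /Pm[] // /prime_exp h.
    by case: nPf; apply: h; split.
  (* Keep the terms in which f j has its least exponent. *)
  exists [set e in A | e oj == em oj]; split.
  - by apply/set0Pn; exists em; rewrite inE emA eqxx.
  - by move=> e; rewrite inE => /andP[/lA].
  - move=> e e' i; rewrite !inE => /andP[eA /eqP ej] /andP[e'A /eqP e'j].
    rewrite ltnS leq_eqVlt => /orP[/eqP ij|]; last exact: eqA.
    by have -> : i = oj; [exact: val_inj|rewrite ej e'j].
  have := Pj1 _ PQ; rewrite (bigID (fun e : {ffun _ -> _} => e oj == em oj)) /=.
  set a := (\sum_(_ in _ | _) _); set b := (\sum_(_ in _ | _) _) => Pab.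
  have Pb : P j.+1 b.
    apply: ideal_sum => // e /andP[eA ne]; apply: ideal_mulr => //.
    have : (0 < e oj - em oj)%N by rewrite subn_gt0 ltn_neqAle emin // andbT eq_sym.
    by case: (_ - _)%N => // m _; rewrite exprS; apply: ideal_mulr.
  rewrite (_ : \sum_(e in _) _ = a); first by rewrite -(addrK b a); exact: ideal_sub.
  apply: eq_big => [e|e]; rewrite !inE // => /andP[_ /eqP ->].
  by rewrite subnn expr0 mul1r.
have [A [/set0Pn[e eA] lA eqA PA]] := step d (leqnn d).
have AE : A =i pred1 e.
  move=> e'; rewrite inE; apply/idP/eqP => [e'A|-> //].
  by apply/ffunP => i; exact: eqA.
have [[_ _ mP] P1 _] := pP d (leqnn d); apply: P1.
move: PA; rewrite (eq_bigl _ _ AE) big_pred1_eq /mon big_pred0; last first.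
  by move=> i; rewrite leqNgt ltn_ord.
move=> /(mP (l e)^-1%:MP); rewrite mul_mpolyC scalerA mulVf ?scale1r //; exact: lA.
Qed.

Definition expo_le (D : nat) (f : S) := forall b, b \in msupp f -> forall i, (b i <= D)%N.

Lemma expo_le_msize f : expo_le (msize f) f.
Proof.
move=> b /msize_mdeg_lt/ltnW; rewrite mdegE => le i; apply: leq_trans le.
by rewrite (bigD1 i) //= leq_addr.
Qed.

Lemma expo_le_mul D E f g : expo_le D f -> expo_le E g -> expo_le (D + E) (f * g).
Proof.
move=> fD gE b /msuppM_le/allpairsP[[x y] /= [xf yg ->]] i.
by rewrite mnmDE leq_add // ?fD ?gE.
Qed.

Lemma expo_le_1 : expo_le 0 1.
Proof. by move=> b; rewrite msupp1 inE => /eqP -> i; rewrite mnm0E. Qed.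

Lemma expo_le_exp D f t : expo_le D f -> expo_le (D * t) (f ^+ t).
Proof.
move=> fD; elim: t => [|t IH]; first by rewrite muln0 expr0; exact: expo_le_1.
by rewrite exprS mulnS; exact: expo_le_mul.
Qed.

Lemma expo_le_leq D E f : (D <= E)%N -> expo_le D f -> expo_le E f.
Proof. by move=> DE fD b bf i; exact: leq_trans (fD b bf i) DE. Qed.

Lemma expo_le_prod D (d : nat) (f : 'I_d -> S) :
  (forall i, expo_le D (f i)) -> expo_le (d * D) (\prod_i f i).
Proof.
move=> fD; rewrite -[d in (d * D)%N]card_ord -sum_nat_const.
by apply: (big_ind2 (fun D f => expo_le D f)) => //; [exact: expo_le_1|move=> *;
  exact: expo_le_mul].
Qed.

(** A chain with [d] steps makes the products of powers of [d] elements, with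
    exponents less than [T], independent modulo the face prime.  These are
    [T ^ d] elements, and modulo the face prime they are combinations of
    monomials in the variables of [F] whose exponents are bounded by a linear
    function of [T].  For large [T] this forces [d <= #|F|]. *)
Lemma dim_face_prime_le F d : dim_quot_ge (@face_prime k n F) d -> (d <= #|F|)%N.
Proof.
case=> P [pP FP chP]; rewrite leqNgt; apply/negP => Fd.
have exf (i : 'I_d) : {f | P i.+1 f /\ ~ P i f}.
  by apply: cid; case: (chP i (ltn_ord i)).
pose f i := projT1 (exf i).
have fP (i : 'I_d) : [/\ forall g, P i g -> P i.+1 g, P i.+1 (f i) & ~ P i (f i)].
  by case: (chP i (ltn_ord i)) => sub _; rewrite /f; case: (exf i) => g [].
pose e := \max_i msize (f i).
have fe i : expo_le e (f i).
  by apply: expo_le_leq (@expo_le_msize _); exact: leq_bigmax.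
(* T exceeds (d * e + 1)^|F|, whence (D + 1)^|F| < T^d when |F| < d. *)
pose T := ((d * e).+1 ^ #|F|).+1.
pose D := (d * (e * T))%N.
have card_lt : (#|{: {ffun {x | x \in F} -> 'I_D.+1}}| < #|{: {ffun 'I_d -> 'I_T}}|)%N.
  rewrite !card_ffun !card_ord card_sig.
  have -> : #|[pred x | x \in F]| = #|F| by apply: eq_card.
  have le1 : (D.+1 <= (d * e).+1 * T)%N.
    by rewrite mulSn /D mulnA -addn1 addnC leq_add2r.
  have le2 : (D.+1 ^ #|F| <= ((d * e).+1 * T) ^ #|F|)%N.
    by case: #|F| => // m; rewrite leq_exp2r.
  apply: leq_ltn_trans le2 _; rewrite expnMn.
  have le3 : (T ^ #|F|.+1 <= T ^ d)%N by rewrite leq_pexp2l.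
  by apply: leq_trans le3; rewrite expnS ltn_pmul2r // expn_gt0.
pose m (y : {ffun {x | x \in F} -> 'I_D.+1}) : 'X_{1..n} :=
  [multinom (if insub i is Some x then nat_of_ord (y x) else 0%N) | i < n].
pose mon (x : {ffun 'I_d -> 'I_T}) := \prod_i f i ^+ x i.
have [l [[x0 lx0] l0]] := exists_linear_relation (fun x y => (mon x)@_(m y)) card_lt.
have mon_le x : expo_le D (mon x).
  apply: (@expo_le_prod (e * T)%N) => i; have := @expo_le_exp _ _ (x i) (fe i).
  by apply: expo_le_leq; rewrite leq_mul2l (ltnW (ltn_ord _)) orbT.
suff : l x0 = 0 by move/eqP; rewrite (negPf lx0).
apply: (chain_alg_indep (P := P) (f := f) pP fP); apply: FP; apply/face_primeE => b.
rewrite mcoeff_msupp => nzb; apply: vars_inN; apply/negP => /vars_inP bF.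
have bD i : (b i < D.+1)%N.
  rewrite ltnNge; apply/negP => Db; move/eqP: nzb; apply.
  rewrite raddf_sum big1 //= => x _; rewrite mcoeffZ.
  rewrite [_@__]memN_msupp_eq0 ?mulr0 //; apply/negP => /mon_le/(_ i).
  by rewrite leqNgt Db.
move/eqP: nzb; apply.
pose y : {ffun {x | x \in F} -> 'I_D.+1} := [ffun x => Ordinal (bD (val x))].
have -> : b = m y.
  apply/mnmP => i; rewrite mnmE; case: insubP => [x _ <-|/bF //].
  by rewrite ffunE.
by rewrite raddf_sum -[RHS](l0 y); apply: eq_bigr => x _; rewrite /= mcoeffZ.
Qed.

Lemma face_prime_le F (G : {set _}) : G \subset F -> forall f, @face_prime k n F f ->
  face_prime G f.
Proof.
move=> GF f /face_primeE FPf; apply/face_primeE => b /FPf [i iF bi].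
by exists i => //; apply: contra iF; exact: (subsetP GF).
Qed.

(** For the lower bound, remove the elements of [F] one at a time. *)
Lemma dim_face_primeE F d : dim_quot_ge (@face_prime k n F) d <-> (d <= #|F|)%N.
Proof.
split=> [|dF]; first exact: dim_face_prime_le.
pose G i := [set x in drop i (enum F)].
exists (fun i => face_prime (G i)); split.
- by move=> i _; exact: face_prime_prime.
- apply: face_prime_le; apply/subsetP => x; rewrite inE drop0 mem_enum //.
- move=> i id; have iF : (i < size (enum F))%N by rewrite -cardE (leq_trans id).
  have x0 : 'I_n by case: (enum F) iF => // x.
  have dE := drop_nth x0 iF.
  split; first by apply: face_prime_le; apply/subsetP => x; rewrite !inE dE inE orbC => ->.
  exists 'X_(nth x0 (enum F) i); split.
    apply/face_primeE/mon_idealX; exists (nth x0 (enum F) i); last by rewrite mnm1E eqxx.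
    rewrite inE; apply/negP => xd; have := enum_uniq (mem F).
    by rewrite -(cat_take_drop i (enum F)) dE cat_uniq /= xd !andbF.
  move/face_primeE/mon_idealX => -[x]; rewrite !inE dE inE mnm1E negb_or =>
    /andP[/negPf xi _].
  by rewrite eq_sym xi.
Qed.
End Krull.

(** * Facets of a simplicial complex *)

Section Facets.
Variable n : nat.
Implicit Types (D E : {set {set 'I_n}}) (F G : {set 'I_n}).

Lemma facetsP D F : reflect
  (F \in D /\ forall G, G \in D -> F \subset G -> G = F) (F \in facets D).
Proof.
rewrite inE; apply: (iffP andP) => -[FD maxF]; split=> //.
  by move=> G GD FG; apply/eqP; exact: (implyP (implyP (forallP maxF G) GD)).
by apply/forall_inP => G GD; apply/implyP => FG; apply/eqP; exact: maxF.
Qed.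

Lemma facet_above D F : F \in D -> exists2 G, G \in facets D & F \subset G.
Proof.
move=> FD; have [G /maxsetP[GD maxG] FG] := maxset_exists (P := mem D) FD.
exists G => //; apply/facetsP; split=> // H HD GH; exact: maxG.
Qed.

Lemma facets_inj D E : simplicial_complex D -> simplicial_complex E ->
  facets D = facets E -> D = E.
Proof.
have sub (A B : {set {set 'I_n}}) : simplicial_complex B -> facets A = facets B ->
  A \subset B.
  move=> cB eqAB; apply/subsetP => F FA; have [G] := facet_above FA.
  by rewrite eqAB => /facetsP[GB _]; exact: cB.
by move=> cD cE eqDE; apply/eqP; rewrite eqEsubset !sub.
Qed.

Lemma dim_succ_facets D d : D != set0 ->
  (forall F, F \in facets D -> #|F| = d) -> dim_succ D = d.
Proof.
case/set0Pn => F0 /facet_above[G0 G0D _] cardD.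
apply/eqP; rewrite eqn_leq; apply/andP; split.
  by apply/bigmax_leqP => F /facet_above[G /cardD <-]; exact: subset_leq_card.
by rewrite -(cardD _ G0D) leq_bigmax_cond //; case/facetsP: G0D.
Qed.
End Facets.

(** * Degree complexes, associated primes and primary components *)

Section DegreeComplex.
Variables (k : fieldType) (n : nat) (I : {mpoly k[n]} -> Prop).
Hypothesis I_mon : monomial_ideal I.
Implicit Types (a b c : 'X_{1..n}) (F G : {set 'I_n}).

Let I_up : upset (fun b => I 'X_[b]). Proof. by case: (monomial_idealP I_mon). Qed.
Let IE f : I f <-> mon_ideal (fun b => I 'X_[b]) f.
Proof. by case: (monomial_idealP I_mon). Qed.
Let I_ideal : is_ideal I.
Proof.
have [i0 iD iM] := mon_ideal_ideal k I_up.
split; first exact/IE.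
  by move=> f g /IE If /IE Ig; apply/IE; exact: iD.
by move=> s f /IE If; apply/IE; exact: iM.
Qed.

Lemma monomial_ideal_ideal : is_ideal I. Proof. exact: I_ideal. Qed.

(** Minimal generators thus detect membership of monomials, so that in the
    definition of the degree complexes all monomials of [I] may be used. *)
Lemma min_generator_below c : I 'X_[c] ->
  exists2 b, min_generator I b & (b <= c)%MM.
Proof.
have [m] := ubnP (mdeg c); elim: m c => // m IH c; rewrite ltnS => cm Ic.
have [minc|] := pselect (forall d : 'X_{1..n}, (d <= c)%MM -> I 'X_[d] -> d = c).
  by exists c; [split|exact: lepm_refl].
move=> /existsNP[d /not_implyP[dc /not_implyP[Id ndc]]].
have [|b bmin bd] := IH d _ Id; last by exists b => //; exact: lepm_trans dc.
apply: leq_trans cm; rewrite -(submK dc) mdegD -[X in (X < _)%N]add0n ltn_add2r.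
rewrite lt0n mdeg_eq0; apply/eqP => e; apply: ndc.
by rewrite -(submK dc) e add0m.
Qed.

Lemma degree_complexP a F : F \in degree_complex I a <->
  forall c, I 'X_[c] -> exists2 i, i \notin F & (a i < c i)%N.
Proof.
rewrite inE; split=> [/asboolP Fa c /min_generator_below[b bmin /mnm_lepP bc]|Fa].
  by have [i iF ab] := Fa b bmin; exists i => //; exact: leq_trans ab (bc i).
by apply/asboolP => b [Ib _]; exact: Fa.
Qed.

Lemma degree_complexPn a F : F \notin degree_complex I a <->
  exists2 c, I 'X_[c] & forall i, i \notin F -> (c i <= a i)%N.
Proof.
split=> [/negP nFa|[c Ic ca]].
  have [|] := pselect (exists2 c, I 'X_[c] & forall i, i \notin F -> (c i <= a i)%N).
    by [].
  move=> nex; case: nFa; apply/degree_complexP => c Ic.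
  apply: contrapT => nlt; apply: nex; exists c => // i iF.
  by rewrite leqNgt; apply/negP => lt; apply: nlt; exists i.
apply/negP => /degree_complexP/(_ c Ic)[i iF]; rewrite ltnNge ca //.
Qed.

Lemma degree_complex_complex a : simplicial_complex (degree_complex I a).
Proof.
move=> F G /degree_complexP Fa GF; apply/degree_complexP => c /Fa[i iF lt].
by exists i => //; apply: contra iF; exact: (subsetP GF).
Qed.

Lemma degree_complex_anti a b : (a <= b)%MM ->
  degree_complex I b \subset degree_complex I a.
Proof.
move=> /mnm_lepP ab; apply/subsetP => F /degree_complexP Fb.
by apply/degree_complexP => c /Fb[i iF lt]; exists i => //; exact: leq_ltn_trans lt.
Qed.

Lemma degree_complex_eq_off a b F G : (forall i, i \notin F -> a i = b i) ->
  F \subset G -> (G \in degree_complex I a) = (G \in degree_complex I b).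
Proof.
move=> ab FG; have abG i : i \notin G -> a i = b i.
  by move=> iG; apply: ab; apply: contra iG; exact: (subsetP FG).
by apply/idP/idP => /degree_complexP Ga; apply/degree_complexP => c /Ga[i iG];
  [rewrite abG|rewrite -abG] => // lt; exists i.
Qed.

Lemma mon_idealMX M (g : {mpoly k[n]}) c :
  mon_ideal M (g * 'X_[c]) <-> mon_ideal (fun b => M (c + b)%MM) g.
Proof.
split=> Mg b bg.
  by apply: Mg; rewrite (perm_mem (msuppMX _ _)); apply: map_f.
by move: bg; rewrite (perm_mem (msuppMX _ _)) => /mapP[d dg ->]; exact: Mg.
Qed.

(** Let [c >= a] be such that [F] is still a face of the complex of [c], with the
    exponents outside [F] as large as possible; they are bounded, since no
    [i |: F] with [i] outside [F] is a face of the complex of [a].  By the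
    choice of [c], multiplying [x^c] by any variable outside [F] and by a high
    power of [x_F] gives an element of [I], whereas no monomial in the
    variables of [F] brings [x^c] into [I].  Hence the face prime is the
    annihilator of the class of [x^c * x_F ^+ N] for large [N]. *)
Lemma facet_associated a F : F \in facets (degree_complex I a) ->
  associated_prime I (face_prime F).
Proof.
case/facetsP => Fa maxF; split; first exact: face_prime_prime.
have /choice[beta betaP] : forall i, exists c, i \notin F ->
    I 'X_[c] /\ forall j, j \notin F -> j != i -> (c j <= a j)%N.
  move=> i; have [iF|iF] := boolP (i \in F); first by exists a.
  have /degree_complexPn[c Ic ca] : i |: F \notin degree_complex I a.
    apply/negP => /maxF/(_ (subsetUr _ _)) e.
    by move: iF; rewrite -e setU11.
  exists c => _; split=> // j jF ji; apply: ca.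
  by rewrite in_setU1 negb_or ji.
pose P t := `[< exists c, [/\ (a <= c)%MM, F \in degree_complex I c & 
    (\sum_(i | i \notin F) c i = t)%N] >].
have P0 : exists t, P t.
  by exists (\sum_(i | i \notin F) a i)%N; apply/asboolP; exists a; rewrite lepm_refl.
have Pbd t : P t -> (t <= \sum_(i | i \notin F) beta i i)%N.
  case/asboolP => c [/mnm_lepP ac Fc <-]; apply: leq_sum => i iF.
  have [Ib ba] := betaP i iF; have /degree_complexP/(_ _ Ib)[j jF lt] := Fc.
  have [ji|ji] := eqVneq j i; first by move: lt; rewrite ji => /ltnW.
  by move: lt; rewrite ltnNge (leq_trans (ba j jF ji)).
case: (ex_maxnP P0 Pbd) => t /asboolP[c [ac Fc ct]] maxt.
have /choice[gam gamP] : forall i, exists d, i \notin F ->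
    I 'X_[d] /\ forall j, j \notin F -> (d j <= (c + U_(i))%MM j)%N.
  move=> i; have [iF|iF] := boolP (i \in F); first by exists a.
  have /degree_complexPn[d Id dc] : F \notin degree_complex I (c + U_(i))%MM.
    apply/negP => Fci; have /maxt : P (t + 1)%N.
      apply/asboolP; exists (c + U_(i))%MM; split=> //.
        by apply: lepm_trans ac _; exact: lem_addr.
      under eq_bigr do rewrite mnmDE.
      rewrite big_split /= ct; congr (_ + _)%N.
      by rewrite (bigD1 i) //= mnm1E eqxx big1 // => j /andP[_ /negPf ji];
        rewrite mnm1E eq_sym ji.
    by rewrite addn1 ltnn.
  by exists d.
(* N is large enough on F for every generator gam i at once. *)
pose N := \max_i mdeg (gam i); pose c' := (c + set_expo F N)%MM.
have IbE b : I 'X_[(c' + b)%MM] <-> var_outside F b.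
  split=> [Ib|[i iF bi]].
    apply: vars_inN; apply/negP => /vars_inP bF.
    have /degree_complexP/(_ _ Ib)[j jF] := Fc.
    by rewrite !mnmDE set_expoE (negPf jF) bF // !addn0 ltnn.
  have [Ig gc] := gamP i iF; apply: I_up Ig _; apply/mnm_lepP => j.
  rewrite !mnmDE set_expoE; case: ifP => jF; last first.
    apply: leq_trans (gc j (negbT jF)) _; rewrite mnmDE mnm1E addn0 leq_add2l.
    by case: eqP => // <-.
  apply: leq_trans (_ : N <= _)%N; last by rewrite addnAC leq_addl.
  by apply: leq_trans (leq_bigmax i); rewrite mdegE (bigD1 j) //= leq_addr.
exists 'X_[c'] => g; rewrite face_primeE IE mon_idealMX.
by split=> h b /h /IbE.
Qed.

Hypothesis I_unmixed : unmixed I.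

Lemma facet_dim a F d : F \in facets (degree_complex I a) ->
  dim_quot_ge I d <-> (d <= #|F|)%N.
Proof. by move=> /facet_associated/I_unmixed ->; exact: dim_face_primeE. Qed.

(** The facets of all degree complexes have one and the same size, the dimension
    of [S/I]. *)
Lemma facet_card a b F G : F \in facets (degree_complex I a) ->
  G \in facets (degree_complex I b) -> #|F| = #|G|.
Proof.
move=> Fa Gb; have FG d : (d <= #|F|)%N <-> (d <= #|G|)%N.
  by rewrite -(facet_dim _ Fa) (facet_dim _ Gb).
by apply/eqP; rewrite eqn_leq (FG _).1 // (FG _).2.
Qed.

Variable Delta : {set {set 'I_n}}.
Hypothesis Delta_complex : simplicial_complex Delta.
Hypothesis sqrt_I : forall f, radical I f <-> stanley_reisner Delta f.

(** Both sides consist of the [F] for which no power of [x_F] lies in [I]. *)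
Lemma degree_complex0 : degree_complex I 0%MM = Delta.
Proof.
apply/setP => F; apply/idP/idP; apply: contraTT => nF; last first.
  have /degree_complexPn[c Ic c0] := nF.
  have /sqrt_I/stanley_reisnerX[G GD /mnm_lepP Gc] : radical I 'X_[c].
    by exists 1%N; rewrite expr1.
  apply/negP => FD; move/negP: GD; apply; apply: Delta_complex FD _.
  apply/subsetP => i iG; have := Gc i; rewrite set_expoE iG.
  by apply: contraLR => /c0; rewrite mnm0E leqn0 -leqNgt leqn0.
have /sqrt_I[t It] : stanley_reisner Delta ('X_[set_expo F 1] : {mpoly k[n]}).
  by apply/stanley_reisnerX; exists F => //; exact: lepm_refl.
apply/degree_complexPn; exists (set_expo F t).
  by rewrite -mono_of_setX mono_of_setE.
by move=> i /negPf iF; rewrite set_expoE iF.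
Qed.

Lemma degree_complex_sub a : degree_complex I a \subset Delta.
Proof. by rewrite -degree_complex0; apply: degree_complex_anti; apply/mnm_lepP => i;
  rewrite mnm0E. Qed.

(** A facet of a degree complex extends to a facet of [Delta], which is the degree
    complex of [0]; by unmixedness both have the same size, so they are equal. *)
Lemma facets_degree_complex a :
  facets (degree_complex I a) = [set F in facets Delta | F \in degree_complex I a].
Proof.
apply/setP => F; rewrite [RHS]inE; apply/idP/andP => [Fa|[/facetsP[FD maxF] Fa]].
  have [FI _] := facetsP _ _ Fa; split=> //.
  have /facet_above[G GD FG] := subsetP (degree_complex_sub a) _ FI.
  suff <- : G = F by [].
  apply/esym/eqP; rewrite eqEcard FG.
  have G0 : G \in facets (degree_complex I 0%MM) by rewrite degree_complex0.
  by rewrite (facet_card Fa G0) leqnn.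
apply/facetsP; split=> // G /(subsetP (degree_complex_sub a)); exact: maxF.
Qed.

(** The saturation of [I] with respect to [x_F].  For a facet [F] of [Delta] it
    is the primary component of [I] at the face prime of [F]. *)
Definition component F : {mpoly k[n]} -> Prop :=
  mon_ideal (fun b => F \notin degree_complex I b).

Lemma component_primary F : F \in facets Delta ->
  primary_ideal (component F) /\ forall f, radical (component F) f <-> face_prime F f.
Proof.
case/facetsP => FD maxF; apply: mon_primary.
- move=> b c Fb bc; apply: contra Fb; exact: (subsetP (degree_complex_anti bc)).
- by rewrite degree_complex0 FD.
- move=> b c c0 /degree_complexPn[d Id dbc]; apply/degree_complexPn; exists d => // i iF.
  by have := dbc i iF; rewrite mnmDE c0 // addn0.
move=> i iF; have : i |: F \notin degree_complex I 0%MM.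
  rewrite degree_complex0; apply/negP => /maxF/(_ (subsetUr _ _)) e.
  by move: iF; rewrite -e setU11.
case/degree_complexPn => d Id d0; exists (d i); apply/degree_complexPn; exists d => // j jF.
rewrite mulmnE mnm1E; have [<-|ij] := eqVneq; first by rewrite mul1n.
by rewrite (leq_trans (d0 j _)) ?mnm0E // in_setU1 negb_or eq_sym ij.
Qed.

(** A monomial outside [I] has a nonvoid degree complex; each facet of the latter
    is a facet of [Delta], and the component of this facet omits the monomial. *)
Lemma component_cap f : I f <-> forall F, F \in facets Delta -> component F f.
Proof.
rewrite IE; split=> [If F FD b /If Ib|If b bf].
  by apply/degree_complexPn; exists b.
have [Fb|/negP] := boolP (set0 \in degree_complex I b); last first.
  move=> /negP/degree_complexPn[c Ic cb]; apply: I_up Ic _; apply/mnm_lepP => i.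
  by apply: cb; rewrite in_set0.
have [F Fb' _] := facet_above Fb.
move: (Fb'); rewrite facets_degree_complex inE => /andP[FD Fb2].
by have := If F FD b bf; rewrite Fb2.
Qed.

Lemma componentX F b : component F 'X_[b] <-> F \notin degree_complex I b.
Proof. exact: mon_idealX. Qed.

Lemma face_prime_set_expo F G t : (0 < t)%N ->
  face_prime F ('X_[set_expo G t] : {mpoly k[n]}) <-> ~~ (G \subset F).
Proof.
move=> t0; rewrite face_primeE mon_idealX; split.
  by case=> i iF; rewrite set_expoE; case: ifP => // iG _; apply/subsetPn; exists i.
by case/subsetPn => i iG iF; exists i => //; rewrite set_expoE iG.
Qed.

(** No component is redundant: for facets [G <> F] a power of [x_F] lies in the
    component of [G], and no power of [x_F] lies in the face prime of [F]. *)
Lemma component_decomposition :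
  minimal_primary_decomposition I
    (fun j : 'I_#|facets Delta| => component (enum_val j)).
Proof.
split.
- by move=> j; case: (component_primary (enum_valP j)).
- move=> f; rewrite component_cap; split=> [h j|h F FD]; first exact/h/enum_valP.
  by rewrite -(enum_rankK_in FD FD).
- move=> i j ij; apply: enum_val_inj.
  have [_ ri] := component_primary (enum_valP i).
  have [_ rj] := component_primary (enum_valP j).
  have PP f : face_prime (enum_val i) f <-> face_prime (enum_val j) (f : {mpoly k[n]}).
    by rewrite -ri -rj.
  have sub (F G : {set 'I_n}) : (forall f : {mpoly k[n]}, face_prime F f ->
    face_prime G f) -> G \subset F.
    move=> FG; apply: contraT => nGF; have /FG/(face_prime_set_expo _ _ (ltnSn 0)) :=
      (face_prime_set_expo F G (ltnSn 0)).2 nGF.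
    by rewrite subxx.
  by apply/eqP; rewrite eqEsubset !sub // => f /PP.
move=> i; have FD := enum_valP i; set F := enum_val i in FD *.
have /choice[g gP] : forall j : 'I_#|facets Delta|, exists g : {mpoly k[n]}, j != i ->
    component (enum_val j) g /\ ~ face_prime F g.
  move=> j; have [_|ji] := eqVneq j i; first by exists 0.
  have GD := enum_valP j; set G := enum_val j in GD *.
  have FG : ~~ (F \subset G).
    apply: contra ji => FG; apply/eqP/enum_val_inj; rewrite -/F -/G.
    by have /facetsP[_ maxF] := FD; apply: maxF => //; case/facetsP: GD.
  have [_ rG] := component_primary GD.
  have /rG[t Gt] := (face_prime_set_expo G F (ltnSn 0)).2 FG.
  exists ('X_[set_expo F 1] ^+ t) => _; split=> // /(prime_exp (face_prime_prime _)).
  by move/face_prime_set_expo => /(_ isT); rewrite subxx.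
exists (\prod_(j | j != i) g j); split.
  move=> j ji; have [[iG _ _] _] := component_primary (enum_valP j).
  by rewrite (bigD1 j) //=; case: (gP j ji) => Gg _; exact: ideal_mulr iG Gg.
have [Fi F1 Fm] := @face_prime_prime k n F.
have cF f : component F f -> face_prime F f.
  by move=> cf; have [_ rF] := component_primary FD; apply/rF; exists 1%N; rewrite expr1.
move=> /cF; elim/big_rec: _ => [//|j f ji IH /Fm[|//]].
by case: (gP j ji).
Qed.

(** The components [component F] give one decomposition.  In an arbitrary one, let
    [D j] belong to the face prime of [F].  This prime is minimal over [I], so
    every other [D i] has an element outside it, and the product [h] of these
    elements is outside it too.  If [x^a] is in [D j], then [h * x^a] is in [I],
    and a monomial of [h] in the variables of [F] shows that [F] is not a face. *)
Lemma primary_componentE F a : F \in facets Delta ->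
  primary_component I (face_prime F) 'X_[a] <-> F \notin degree_complex I a.
Proof.
move=> FD; split; last first.
  move=> Fa; exists #|facets Delta|, (fun j => component (enum_val j)), (enum_rank_in FD F).
  split; first exact: component_decomposition.
  - by move=> g; rewrite enum_rankK_in //; case: (component_primary FD).
  - by rewrite enum_rankK_in //; apply/componentX.
case=> r [D [j [[Dp DI Dinj _] rj Dj]]].
have [iF F1 Fm] := @face_prime_prime k n F.
have /choice[g gP] : forall i, exists g, i != j -> D i g /\ ~ face_prime F g.
  move=> i; have [_|ij] := eqVneq i j; first by exists 0.
  have [[g [Dg Fg]]|nex] := pselect (exists g, D i g /\ ~ face_prime F g);
    first by exists g.
  have DF g : D i g -> face_prime F g.
    by move=> Dg; apply: contrapT => Fg; apply: nex; exists g.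
  suff ijE : i = j by rewrite ijE eqxx in ij.
  apply: Dinj => f; rewrite rj; split.
    by case=> t /DF/(prime_exp (face_prime_prime F)).
  have [Di D1 Dm] := Dp i.
  apply: face_prime_sub; first exact: radical_ideal.
  move=> l lF.
  have /sqrt_I[t] : stanley_reisner Delta ('X_[set_expo (l |: F) 1] : {mpoly k[n]}).
    apply/stanley_reisnerX; exists (l |: F); last exact: lepm_refl.
    apply/negP => lFD; have /facetsP[_ /(_ _ lFD (subsetUr _ _)) e] := FD.
    by move: lF; rewrite -e setU11.
  have -> : set_expo (l |: F) 1 = (U_(l) + set_expo F 1)%MM.
    apply/mnmP => i'; rewrite mnmDE !set_expoE mnm1E in_setU1.
    have [->|_] := eqVneq i' l; last by [].
    by rewrite (negPf lF).
  rewrite mpolyXD exprMn => /DI/(_ i)/Dm[Dl|[s Ds]]; first by exists t.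
  have := DF _ Ds; do 2!move/(prime_exp (face_prime_prime F)).
  by move/face_prime_set_expo => /(_ isT); rewrite subxx.
pose h := \prod_(i | i != j) g i.
have nh : ~ face_prime F h.
  rewrite /h; elim/big_rec: _ => [//|i f ij IH /Fm[|//]].
  by case: (gP i ij).
have : I (h * 'X_[a]).
  apply/DI => i; have [->|ij] := eqVneq i j.
    by have [[_ _ mD] _ _] := Dp j; exact: mD.
  have [iD _ _] := Dp i; apply: ideal_mulr => //.
  by rewrite /h (bigD1 i) //=; apply: ideal_mulr => //; case: (gP i ij).
move/IE/mon_idealMX => Ih; apply/negP => Fa; apply: nh; apply/face_primeE => b /Ih Ib.
apply: vars_inN; apply/negP => /vars_inP bF.
have /degree_complexP/(_ _ Ib)[i iF'] := Fa.
by rewrite mnmDE bF // addn0 ltnn.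
Qed.

Lemma in_L_degree_complex Gamma a : simplicial_complex Gamma ->
  facets Gamma \subset facets Delta ->
  in_L Delta I Gamma a <-> Gamma = degree_complex I a.
Proof.
move=> cG sub; split=> [[inF outF]|GE].
  apply: facets_inj => //; first exact: degree_complex_complex.
  apply/setP => F; rewrite facets_degree_complex inE.
  apply/idP/andP => [FG|[FD Fa]].
    have FD := subsetP sub _ FG; split=> //.
    by apply/negPn/negP => Fa; apply: (outF _ FG); apply/primary_componentE.
  apply: contraT => FG; have : F \in facets Delta :\: facets Gamma by rewrite inE FG.
  by move/inF/primary_componentE => /(_ FD); rewrite Fa.
split=> F.
  rewrite inE GE facets_degree_complex inE => /andP[nF FD].
  by apply/primary_componentE => //; move: nF; rewrite FD.
rewrite GE facets_degree_complex inE => /andP[FD Fa] /primary_componentE => /(_ FD).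
by rewrite Fa.
Qed.

End DegreeComplex.

(** * Dickson's lemma *)

Section Dickson.

(** Choose at each step an index where [f] attains its minimum over the remaining
    indices. *)
Lemma nondecreasing_subseq (f : nat -> nat) : exists phi : nat -> nat,
  (forall p, (phi p < phi p.+1)%N) /\ forall p, (f (phi p) <= f (phi p.+1))%N.
Proof.
have /choice[g gP] : forall m, exists p, (m <= p)%N /\ forall q, (m <= q)%N ->
  (f p <= f q)%N.
  move=> m; pose P t := `[< exists p, (m <= p)%N /\ f p = t >].
  have P0 : exists t, P t by exists (f m); apply/asboolP; exists m.
  case: (ex_minnP P0) => t /asboolP[p [mp <-]] minp; exists p; split=> // q mq.
  by apply: minp; apply/asboolP; exists q.
pose fix phi p := if p is p'.+1 then g (phi p').+1 else g 0%N.
have inc p : (phi p < phi p.+1)%N by case: (gP (phi p).+1).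
exists phi; split=> // p.
have [m [mp ->]] : exists m, (m <= phi p)%N /\ phi p = g m.
  by case: p => [|p]; [exists 0%N|exists (phi p).+1].
case: (gP m) => _; apply; apply: leq_trans mp _; exact: ltnW.
Qed.

Lemma nondecreasing_subseq_multi (n : nat) (s : nat -> 'X_{1..n}) :
  exists phi : nat -> nat, (forall p, (p <= phi p)%N) /\
    forall p, (s (phi 0%N) <= s (phi p))%MM.
Proof.
have [phi [inc mono]] : exists phi : nat -> nat, (forall p, (phi p < phi p.+1)%N) /\
    forall i, i \in enum 'I_n -> forall p, (s (phi p) i <= s (phi p.+1) i)%N.
  elim: (enum 'I_n) => [|j l [phi [inc mono]]].
    by exists id; split=> // i.
  have [psi [inc' mono']] := nondecreasing_subseq (fun p => s (phi p) j).
  have homo_inc := homo_ltn ltn_trans inc.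
  exists (phi \o psi); split=> [p|i]; first by apply: homo_inc; exact: inc'.
  rewrite inE => /orP[/eqP -> //|il p] /=.
  apply: (homo_leq (f := fun p => s (phi p) i) (r := leq)) => //.
  - exact: leq_trans.
  - exact: mono.
  - exact/ltnW.
exists phi; split; first by elim=> // p IH; exact: leq_ltn_trans (inc p).
elim=> [|p IH]; first exact: lepm_refl.
by apply: lepm_trans IH _; apply/mnm_lepP => i; apply: mono; rewrite mem_enum.
Qed.

(** If a coordinate were unbounded, there would be a sequence in [P] along which
    it tends to infinity, and which is nondecreasing in all coordinates.  By the
    antichain property all its terms would equal the first one. *)
Lemma antichain_bounded (n : nat) (P : 'X_{1..n} -> Prop) :
  (forall b c : 'X_{1..n}, P b -> P c -> (b <= c)%MM -> b = c) ->
  exists N, forall b : 'X_{1..n}, P b -> forall i, (b i < N)%N.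
Proof.
move=> antiP; have /choice[N NP] : forall i, exists N, forall b : 'X_{1..n}, P b ->
  (b i < N)%N.
  move=> i; apply: contrapT => nN.
  have /choice[s sP] : forall r, exists b : 'X_{1..n}, P b /\ (r <= b i)%N.
    move=> r; apply: contrapT => nb; apply: nN; exists r => b Pb.
    by rewrite ltnNge; apply/negP => rb; apply: nb; exists b.
  have [phi [le mono]] := nondecreasing_subseq_multi s.
  pose q := (s (phi 0%N) i).+1.
  have e := antiP _ _ (sP (phi 0%N)).1 (sP (phi q)).1 (mono q).
  have := leq_trans (le q) (sP (phi q)).2.
  by rewrite -e ltnn.
exists (\max_i N i) => b Pb i; exact: leq_trans (NP i b Pb) (leq_bigmax i).
Qed.
End Dickson.

(** * Incidence signs *)

Section Signs.
Variables (R : comNzRingType) (n : nat).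
Implicit Types (A B : {set 'I_n}) (v w : 'I_n).

Lemma inc_signE v A : inc_sign R v A = \prod_(w in A) (-1) ^+ (w < v)%N.
Proof.
rewrite /inc_sign prodrXr; congr (_ ^+ _).
rewrite -sum1_card big_mkcond [RHS]big_mkcond; apply: eq_bigr => w _.
by rewrite inE; case: (w \in A) => //=; case: (w < v)%N.
Qed.

Lemma inc_sign_sq v A : inc_sign R v A * inc_sign R v A = 1.
Proof. by rewrite -expr2 sqrr_sign. Qed.

Lemma inc_signD1 v A : inc_sign R v (A :\ v) = inc_sign R v A.
Proof.
rewrite !inc_signE [RHS](bigID (pred1 v)) /= [X in _ = X * _]big1 ?mul1r.
  by apply: eq_bigl => w; rewrite in_setD1 andbC.
by move=> w /andP[_ /eqP ->]; rewrite ltnn.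
Qed.

Lemma inc_signU1 v w A : w \notin A ->
  inc_sign R v (w |: A) = (-1) ^+ (w < v)%N * inc_sign R v A.
Proof. by move=> wA; rewrite !inc_signE big_setU1. Qed.

Lemma inc_signU v A B : [disjoint A & B] ->
  inc_sign R v (A :|: B) = inc_sign R v A * inc_sign R v B.
Proof.
by move=> AB; rewrite !inc_signE -bigU //; apply: eq_bigl => w; rewrite inE.
Qed.

End Signs.

(** * Cohomology of stars and homology of links *)

Section Cohomology.
Variables (k : fieldType) (n : nat).
Implicit Types (u w : {set 'I_n} -> k) (Gam : {set {set 'I_n}}) (F G H : {set 'I_n}).

(** The transpose of [boundary], and the coefficientwise form of [cech_diff]. *)
Definition codiff u G : k := \sum_(v in G) inc_sign k v G * u (G :\ v).

(** Vanishing in degree [i] of the cohomology of the faces of [Gam] that contain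
    [F].  Cochains are not required to vanish outside [Gam]; instead, equations
    are imposed only on the faces of [Gam], as in the Cech complex, where they
    hold modulo [I]. *)
Definition cohom_zero Gam F (i : nat) : Prop :=
  forall u, (forall H, u H != 0 -> #|H| = i /\ F \subset H) ->
    (forall G, G \in Gam -> F \subset G -> #|G| = i.+1 -> codiff u G = 0) ->
  exists w, (forall H, w H != 0 -> #|H|.+1 = i /\ F \subset H) /\
    forall H, H \in Gam -> F \subset H -> #|H| = i -> u H = codiff w H.

(** The contracting homotopy of a cone: [w H] is, up to sign, the value of [u] on
    [H] with the apex [j] added. *)
Lemma cohom_zero_cone Gam F i (j : 'I_n) : j \notin F ->
  (forall G, G \in Gam -> F \subset G -> j |: G \in Gam) -> cohom_zero Gam F i.
Proof.
move=> jF cone u uP uco.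
pose w H := if j \in H then 0 else inc_sign k j H * u (j |: H).
have FjU H : F \subset j |: H -> F \subset H.
  move=> /subsetP FH; apply/subsetP => x xF; have := FH x xF.
  by rewrite in_setU1 => /orP[/eqP xj|//]; rewrite -xj xF in jF.
exists w; split=> [H|H HG FH Hi].
  rewrite /w; case: ifP => jH; rewrite ?eqxx // mulf_eq0 negb_or => /andP[_ /uP[]].
  by rewrite cardsU1 jH => <- /FjU.
have [jH|jH] := boolP (j \in H).
  rewrite /codiff (bigD1 j) //= big1 ?addr0 => [|v /andP[vH vj]].
    rewrite /w setD11 setD1K // inc_signD1 mulrA inc_sign_sq mul1r //.
  by rewrite /w in_setD1 eq_sym vj jH /= mulr0.
have := uco _ (cone H HG FH) (subset_trans FH (subsetUr _ _)).
rewrite cardsU1 jH Hi => /(_ erefl).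
rewrite /codiff big_setU1 //= setU1K // inc_signU1 // ltnn expr0 mul1r.
move/(congr1 (fun x => inc_sign k j H * x)); rewrite mulr0 mulrDr mulrA inc_sign_sq mul1r.
move/eqP; rewrite addr_eq0 => /eqP ->; rewrite mulr_sumr -sumrN; apply: eq_bigr => v vH.
have vj : v != j by apply: contraNneq jH => <-.
rewrite /w in_setD1 (negPf jH) andbF /= inc_signU1 //.
have -> : (j |: H) :\ v = j |: H :\ v.
  apply/setP => x; rewrite !inE; have [->|//] := eqVneq x v.
  by rewrite (negPf vj).
have -> : inc_sign k j H = (-1) ^+ (v < j)%N * inc_sign k j (H :\ v).
  by rewrite -inc_signU1 ?setD11 // setD1K.
have sgn : (-1) ^+ (v < j)%N * (-1) ^+ (j < v)%N = -1 :> k.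
  case: (ltngtP v j) => [_|_|/val_inj e]; rewrite ?mulr1 ?mul1r //.
  by rewrite e eqxx in vj.
rewrite !mulrA -mulNr; congr (_ * _).
by rewrite [X in - (X * _)]mulrAC sgn mulN1r mulNr opprK mulrC.
Qed.

(** The sign of [v] in [H :|: F] is the product of its signs in [H] and in [F];
    the second factor depends on [v] only, and the product of these factors
    over [H] makes the link complex a shift of the star complex. *)
Definition link_sign F H : k := \prod_(v in H) inc_sign k v F.

Lemma link_sign_sq F H : link_sign F H * link_sign F H = 1.
Proof. by rewrite -big_split big1 // => v _; exact: inc_sign_sq. Qed.

Lemma codiff_link u F H : (forall G, u G != 0 -> F \subset G) -> [disjoint H & F] ->
  codiff (fun G => link_sign F G * u (G :|: F)) H = link_sign F H * codiff u (H :|: F).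
Proof.
move=> uF HF; rewrite /codiff [\sum_(v in H :|: F) _](bigID (mem F)) /=.
rewrite [X in _ = _ * (X + _)]big1 ?add0r => [|v /andP[_ vF]]; last first.
  rewrite (contraNeq (@uF _)) ?mulr0 //; apply/subsetPn; exists v => //.
  by rewrite setD11.
have eqH v : (v \in H :|: F) && (v \notin F) = (v \in H).
  rewrite inE; case: (boolP (v \in H)) => /= [vH|_]; last by case: (v \in F).
  by rewrite (disjointFr HF vH).
rewrite (eq_bigl _ _ eqH) mulr_sumr; apply: eq_bigr => v vH.
have vF : v \notin F by rewrite (disjointFr HF vH).
have -> : (H :|: F) :\ v = H :\ v :|: F.
  by rewrite setDUl; congr (_ :|: _); apply/setDidPl; rewrite disjoint_sym disjoints1.
have -> : link_sign F H = inc_sign k v F * link_sign F (H :\ v).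
  rewrite /link_sign (big_setD1 v) //.
rewrite inc_signU // -[LHS]mul1r -(inc_sign_sq k v F); ring.
Qed.

Lemma codiff_eq u w H : (forall v, v \in H -> u (H :\ v) = w (H :\ v)) ->
  codiff u H = codiff w H.
Proof. by move=> uw; apply: eq_bigr => v vH; rewrite uw. Qed.

Lemma codiff_neq0 u H : codiff u H != 0 -> exists2 v, v \in H & u (H :\ v) != 0.
Proof.
move=> nz; suff /existsP[v /andP[vH uv]] : [exists v, (v \in H) && (u (H :\ v) != 0)].
  by exists v.
apply: contraNT nz; rewrite negb_exists => /forallP all0.
apply/eqP/big1 => v vH; have := all0 v; rewrite vH /= negbK => /eqP ->; exact: mulr0.
Qed.

Lemma linkP Gam F H : H \in link Gam F <->
  [/\ H \in Gam, H :|: F \in Gam & [disjoint H & F]].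
Proof.
rewrite inE -setI_eq0; split; first by case/and3P.
by case=> -> ->.
Qed.

(** The cohomology of the link in its own grading, where [m] is the number of
    vertices.  It serves as the middle term between the homology of the link
    and the cohomology of the star. *)
Definition link_cohom_zero Gam F (m : nat) : Prop :=
  forall u, (forall H, u H != 0 -> H \in link Gam F /\ #|H| = m) ->
    (forall G, G \in link Gam F -> #|G| = m.+1 -> codiff u G = 0) ->
  exists w, (forall H, w H != 0 -> #|H|.+1 = m) /\
    forall H, H \in link Gam F -> #|H| = m -> u H = codiff w H.

Lemma link_sub Gam F G H : simplicial_complex Gam -> H \in link Gam F -> G \subset H ->
  G \in link Gam F.
Proof.
move=> cG /linkP[HG HFG HF] GH; apply/linkP; split.
- exact: cG HG GH.
- exact: cG HFG (setSU _ GH).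
- exact: disjointWl GH HF.
Qed.

Lemma setDKU G F : F \subset G -> G :\: F :|: F = G.
Proof. by move=> FG; rewrite setUC -{1}(setIidPr FG) setID. Qed.

Lemma disjoint_setDl G F : [disjoint G :\: F & F].
Proof. by rewrite disjoints_subset; apply/subsetP => x; rewrite !inE => /andP[]. Qed.

Lemma card_setDF G F : F \subset G -> (#|G :\: F| + #|F|)%N = #|G|.
Proof. by move=> FG; rewrite addnC -(cardsID F G) (setIidPr FG). Qed.

Lemma mem_linkD Gam F G : simplicial_complex Gam -> G \in Gam -> F \subset G ->
  G :\: F \in link Gam F.
Proof.
move=> cGam GG FG; apply/linkP; split; last exact: disjoint_setDl.
  exact: cGam GG (subsetDl _ _).
by rewrite setDKU.
Qed.

Lemma card_linkU F H : [disjoint H & F] -> #|H :|: F| = (#|H| + #|F|)%N.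
Proof. by rewrite -leq_card_setU => /eqP. Qed.

Definition to_star F u G : k :=
  if F \subset G then link_sign F (G :\: F) * u (G :\: F) else 0.

Lemma to_starP F u G : to_star F u G != 0 -> F \subset G /\ u (G :\: F) != 0.
Proof.
rewrite /to_star; case: ifP => [FG|]; last by rewrite eqxx.
by rewrite mulf_eq0 negb_or => /andP[].
Qed.

Lemma to_starK F u H : [disjoint H & F] -> link_sign F H * to_star F u (H :|: F) = u H.
Proof.
move=> HF; rewrite /to_star subsetUr setDUl setDv setU0 (setDidPl HF).
by rewrite mulrA link_sign_sq mul1r.
Qed.

Lemma codiff_to_star F u G : F \subset G ->
  codiff u (G :\: F) = link_sign F (G :\: F) * codiff (to_star F u) G.
Proof.
move=> FG; have tF G' : to_star F u G' != 0 -> F \subset G' by case/to_starP.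
have := codiff_link tF (disjoint_setDl G F); rewrite setDKU // => <-.
apply: codiff_eq => v vH.
by rewrite to_starK // (disjointWl (subsetDl _ _)) // disjoint_setDl.
Qed.

Lemma cohom_zero_link Gam F m : simplicial_complex Gam ->
  cohom_zero Gam F (m + #|F|) <-> link_cohom_zero Gam F m.
Proof.
move=> cGam; split=> coh u uP uco.
- have [||w [wP wE]] := coh (to_star F u).
  + move=> G /to_starP[FG /uP[_ <-]]; by rewrite card_setDF.
  + move=> G GG FG cG; have := uco (G :\: F) (mem_linkD cGam GG FG).
    rewrite codiff_to_star // => /(_ _)/(congr1 (fun x => link_sign F (G :\: F) * x)).
    rewrite mulrA link_sign_sq mul1r mulr0; apply.
    by apply/eqP; rewrite -(eqn_add2r #|F|) card_setDF // cG.
  exists (fun H => if #|H|.+1 == m then link_sign F H * w (H :|: F) else 0); split.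
    by move=> H; case: (#|H|.+1 =P m) => [-> _|_]; rewrite ?eqxx.
  move=> H HL cH; have /linkP[HG HFG HF] := HL.
  rewrite -[LHS](to_starK u HF) wE ?subsetUr ?card_linkU ?cH //.
  rewrite -codiff_link //; last by move=> G /wP[].
  apply: codiff_eq => v vH; move: cH; rewrite (cardsD1 v) vH add1n => ->.
  by rewrite eqxx.
have [||w [wP wE]] := coh (fun H =>
  if H \in link Gam F then link_sign F H * u (H :|: F) else 0).
- move=> H; case: ifP => [HL|]; last by rewrite eqxx.
  rewrite mulf_eq0 negb_or => /andP[_ /uP[cH _]]; split=> //.
  have /linkP[_ _ HF] := HL.
  by apply/eqP; rewrite -(eqn_add2r #|F|) -card_linkU // cH.
- move=> H HL cH; have /linkP[HG HFG HF] := HL.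
  rewrite (codiff_eq (w := fun H => link_sign F H * u (H :|: F))); last first.
    by move=> v vH; rewrite (link_sub cGam HL) // subsetDl.
  rewrite codiff_link //; last by move=> G /uP[].
  by rewrite uco ?mulr0 ?subsetUr // card_linkU // cH.
exists (to_star F w); split.
  move=> G /to_starP[FG /wP <-]; split=> //.
  by rewrite addSn card_setDF.
move=> G GG FG cG; have HL := mem_linkD cGam GG FG.
have cH : #|G :\: F| = m by apply/eqP; rewrite -(eqn_add2r #|F|) card_setDF // cG.
have := wE _ HL cH; rewrite HL codiff_to_star // setDKU //.
move/(congr1 (fun x => link_sign F (G :\: F) * x)).
by rewrite !mulrA link_sign_sq !mul1r.
Qed.

Definition boundary_coef H G : k := \sum_(v | (v \notin G) && (v |: G == H)) inc_sign k v G.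

Lemma boundaryE (c : {set 'I_n} -> k) G :
  \sum_H c H * boundary_coef H G = \sum_(v | v \notin G) inc_sign k v G * c (v |: G).
Proof.
under eq_bigr do rewrite mulr_sumr big_mkcondr /=.
rewrite exchange_big; apply: eq_bigr => v _ /=.
rewrite (bigD1 (v |: G)) //= eqxx mulrC big1 ?addr0 // => H.
by rewrite eq_sym => /negPf ->.
Qed.

Lemma codiffE u H : \sum_G boundary_coef H G * u G = codiff u H.
Proof.
under eq_bigr do rewrite mulr_suml big_mkcond /=.
rewrite exchange_big /codiff [RHS]big_mkcond; apply: eq_bigr => v _ /=.
case: (boolP (v \in H)) => vH.
  rewrite (bigD1 (H :\ v)) //= setD11 setD1K // eqxx inc_signD1 big1 ?addr0 // => G ne.
  case: ifP => // /andP[vG /eqP e]; case/eqP: ne; by rewrite -e setU1K.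
rewrite big1 // => G _; case: ifP => // /andP[_ /eqP e].
by rewrite -e setU11 in vH.
Qed.

Lemma link_complex Gam F : simplicial_complex Gam -> simplicial_complex (link Gam F).
Proof. by move=> cGam H G HL GH; exact: link_sub HL GH. Qed.

Lemma homology_zero_link Gam F m : simplicial_complex Gam ->
  reduced_homology_zero k (link Gam F) m <-> link_cohom_zero Gam F m.
Proof.
move=> cGam; have cL := @link_complex Gam F cGam.
pose P := [pred H : {set 'I_n} | (H \in link Gam F) && (#|H| == m)].
pose Q := [pred H : {set 'I_n} | (H \in link Gam F) && (#|H| == m.+1)].
pose R := [pred H : {set 'I_n} | #|H|.+1 == m].
split=> coh.
  move=> u uP uco; have [|||w [wR wE]] := @exact_dual k _ boundary_coef P Q R _ u.
  - move=> c cP cR; have [||d [dQ cE]] := coh (finfun c).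
    + move=> H; rewrite ffunE => nz; have : P H by apply: contraNT nz => /cP ->.
      by case/andP => ? /eqP.
    + apply/ffunP => G; rewrite !ffunE.
      under eq_bigr do rewrite ffunE.
      have [Gm|Gm] := eqVneq #|G|.+1 m.
        by rewrite -boundaryE cR //= Gm.
      apply: big1 => v vG; rewrite cP ?mulr0 //=; rewrite negb_and.
      by rewrite cardsU1 vG add1n Gm orbT.
    exists d; split=> [H nQ|G PG].
      apply/eqP; apply: contraNT nQ => /dQ[HL cH]; by rewrite /= HL cH eqxx.
    have := congr1 (fun f : {ffun _ -> _} => f G) cE; rewrite !ffunE => ->.
    by rewrite boundaryE.
  - move=> H nP; apply/eqP; apply: contraNT nP => /uP[HL cH]; by rewrite /= HL cH eqxx.
  - by move=> H /andP[HL /eqP cH]; rewrite codiffE uco.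
  exists w; split=> [H nz|H HL cH].
    by apply/eqP; apply: contraNT nz => /wR ->.
  by rewrite -codiffE; apply: wE; rewrite /= HL cH eqxx.
move=> c cP c0; have [|||d [dQ dE]] := @exact_dual k _ (fun G H =>
  boundary_coef H G) P R Q _ c.
- move=> u uP uco; have [||w [wR wE]] := coh u.
  + by move=> H nz; have : P H by [apply: contraNT nz => /uP ->]; case/andP => ? /eqP.
  + move=> G GL cG; rewrite -codiffE.
    under eq_bigr do rewrite mulrC.
    by apply: uco; rewrite /= GL cG eqxx.
  exists w; split=> [H nR|H /andP[HL /eqP cH]].
    by apply/eqP; apply: contraNT nR => /wR cH; rewrite /= cH.
  rewrite (wE H HL cH) -codiffE; apply: eq_bigr => G _; exact: mulrC.
- by move=> H nP; apply/eqP; apply: contraNT nP => /cP[HL cH]; rewrite /= HL cH eqxx.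
- move=> G _; have := congr1 (fun f : {ffun _ -> _} => f G) c0; rewrite !ffunE => {}c0.
  apply: etrans c0; rewrite -boundaryE; apply: eq_bigr => H _; exact: mulrC.
exists (finfun d); split.
  move=> H; rewrite ffunE => nz; have : Q H by apply: contraNT nz => /dQ ->.
  by case/andP => ? /eqP.
apply/ffunP => G; rewrite ffunE; under eq_bigr do rewrite ffunE.
have [PG|nPG] := boolP (P G).
  by rewrite dE // -boundaryE; apply: eq_bigr => H _; exact: mulrC.
have -> : c G = 0 by apply/eqP; apply: contraNT nPG => /cP[GL cG]; rewrite /= GL cG eqxx.
apply/esym/big1 => v vG; rewrite dQ ?mulr0 //=; apply: contra nPG => /andP[UL].
rewrite cardsU1 vG add1n eqSS => cG; rewrite /= cG andbT.
exact: cL UL (subsetUr _ _).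
Qed.

(** For the link complex, homology and cohomology vanish together because its
    coboundary is the transpose of its boundary. *)
Lemma homology_zero_cohom Gam F m : simplicial_complex Gam ->
  reduced_homology_zero k (link Gam F) m <-> cohom_zero Gam F (m + #|F|).
Proof. by move=> cGam; rewrite homology_zero_link // cohom_zero_link. Qed.

End Cohomology.

(** * The Cech complex as a complex of modules *)

Section CechAlgebra.
Variables (k : fieldType) (n : nat).
Local Notation S := {mpoly k[n]}.
Local Notation K := {fraction {mpoly k[n]}}.
Local Notation tofrac := (@FracField.tofrac {mpoly k[n]}).
Implicit Types (J : S -> Prop) (c e : {ffun {set 'I_n} -> K}) (F G H : {set 'I_n}) (s : S).

Lemma tofracX_neq0 (m : 'X_{1..n}) : tofrac 'X_[m] != 0.
Proof. by rewrite tofrac_eq0 -msupp_eq0 msuppX. Qed.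

Lemma loc_ideal0 J F : is_ideal J -> loc_ideal J F 0.
Proof. by case=> J0 _ _; exists 0, 0%N; rewrite tofrac0 mul0r. Qed.

Lemma loc_idealD J F p q : is_ideal J -> loc_ideal J F p -> loc_ideal J F q ->
  loc_ideal J F (p + q).
Proof.
move=> iJ [f [t [Jf ->]]] [g [u [Jg ->]]].
exists (f * mono_of_set k F ^+ u + g * mono_of_set k F ^+ t), (t + u)%N; split.
  by case: (iJ) => _ aJ _; apply: aJ; exact: ideal_mulr.
have nz m : tofrac (mono_of_set k F ^+ m) != 0 by rewrite mono_of_setX tofracX_neq0.
by rewrite exprD tofracD !tofracM (addf_div _ _ (nz t) (nz u)).
Qed.

Lemma loc_idealM J F s q : is_ideal J -> loc_ideal J F q -> loc_ideal J F (tofrac s * q).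
Proof.
move=> [_ _ mJ] [f [t [Jf ->]]]; exists (s * f), t; split; first exact: mJ.
by rewrite tofracM mulrA.
Qed.

Lemma loc_ideal_sub J F G q : is_ideal J -> F \subset G -> loc_ideal J F q ->
  loc_ideal J G q.
Proof.
move=> iJ FG [f [t [Jf ->]]]; exists (f * 'X_[set_expo (G :\: F) t]), t; split.
  exact: ideal_mulr.
rewrite !mono_of_setX; apply/eqP; rewrite eqr_div ?tofracX_neq0 // -!tofracM.
rewrite -mulrA -mpolyXD; apply/eqP; congr (tofrac (_ * 'X_[_])).
apply/mnmP => i; rewrite mnmDE !set_expoE in_setD.
case: (boolP (i \in F)) => [/(subsetP FG) ->|_]; first by [].
by rewrite /= addn0.
Qed.

Lemma cech_diffD c e : cech_diff (c + e) = cech_diff c + cech_diff e.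
Proof.
apply/ffunP => G; rewrite !ffunE -big_split; apply: eq_bigr => v _.
by rewrite !ffunE mulrDr.
Qed.

Lemma cech_diff_act s c : cech_diff (cech_act s c) = cech_act s (cech_diff c).
Proof.
by apply/ffunP => G; rewrite !ffunE mulr_sumr; apply: eq_bigr => v _; rewrite !ffunE mulrCA.
Qed.

Lemma cech_diff0 : cech_diff (0 : {ffun {set 'I_n} -> K}) = 0.
Proof. by apply/ffunP => G; rewrite !ffunE big1 // => v _; rewrite ffunE mulr0. Qed.

Lemma cech_diffN c : cech_diff (- c) = - cech_diff c.
Proof.
by apply/eqP; rewrite -addr_eq0 -cech_diffD addNr cech_diff0.
Qed.

(** The terms for [(v, w)] and [(w, v)] cancel: removing [v] changes the sign of
    [w] exactly when [v < w]. *)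
Lemma cech_diff_diff c : cech_diff (cech_diff c) = 0.
Proof.
apply/ffunP => G; rewrite !ffunE.
pose t v w := inc_sign K v G * inc_sign K w G * c (G :\ v :\ w).
have tC v w : t v w = t w v.
  rewrite /t [inc_sign K v G * _]mulrC; congr (_ * c _).
  by apply/setP => x; rewrite !inE andbCA.
have -> : \sum_(v in G) inc_sign K v G * cech_diff c (G :\ v) =
    \sum_(v in G) \sum_(w in G | w != v) (-1) ^+ (v < w)%N * t v w.
  apply: eq_bigr => v vG; rewrite ffunE mulr_sumr.
  apply: eq_big => [w|w]; first by rewrite in_setD1 andbC.
  rewrite in_setD1 => /andP[wv wG]; rewrite /t.
  have -> : inc_sign K w G = (-1) ^+ (v < w)%N * inc_sign K w (G :\ v).
    by rewrite -inc_signU1 ?setD11 // setD1K.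
  rewrite [LHS]mulrA [RHS]mulrA; congr (_ * _).
  by rewrite [RHS]mulrCA signrMK.
have split_t v : \sum_(w in G | w != v) (-1) ^+ (v < w)%N * t v w =
    \sum_(w in G | (w < v)%N) t v w - \sum_(w in G | (v < w)%N) t v w.
  rewrite (bigID (fun w : 'I_n => (w < v)%N)) /=; congr (_ + _).
    apply: eq_big => [w|w /andP[_ wv]]; last by rewrite ltnNge ltnW // mul1r.
    by rewrite -andbA; congr (_ && _); rewrite andbC -val_eqE; case: ltngtP.
  rewrite -sumrN; apply: eq_big => [w|w /andP[/andP[_ wv] vw]].
    by rewrite -andbA; congr (_ && _); rewrite -val_eqE; case: ltngtP.
  by rewrite (_ : (v < w)%N) ?mulN1r // ltn_neqAle eq_sym val_eqE wv leqNgt.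
under eq_bigr do rewrite split_t.
rewrite sumrB (exchange_big_dep (mem G)) /= => [|v w _ /andP[]//].
rewrite -sumrB big1 // => v vG; apply/eqP; rewrite subr_eq0; apply/eqP.
by apply: eq_big => [w|w _]; [rewrite vG|exact: tC].
Qed.

Lemma cech_cochain0 J i : is_ideal J -> cech_cochain J i 0.
Proof. by move=> iJ F; rewrite ffunE; case: ifP => // _; exact: loc_ideal0. Qed.

Lemma cech_cochainD J i c e : is_ideal J -> cech_cochain J i c -> cech_cochain J i e ->
  cech_cochain J i (c + e).
Proof.
move=> iJ cJ eJ F; have := cJ F; have := eJ F; rewrite ffunE.
by case: ifP => _ => [? ?|-> ->]; [exact: loc_idealD|rewrite addr0].
Qed.

Lemma cech_cochain_act J i s c : is_ideal J -> cech_cochain J i c ->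
  cech_cochain J i (cech_act s c).
Proof.
move=> iJ cJ F; have := cJ F; rewrite ffunE.
by case: ifP => _ => [?|->]; [exact: loc_idealM|rewrite mulr0].
Qed.

Lemma cech_act_sum (T : Type) (r : seq T) s (f : T -> {ffun {set 'I_n} -> K}) :
  cech_act s (\sum_(x <- r) f x) = \sum_(x <- r) cech_act s (f x).
Proof.
apply/ffunP => F; rewrite ffunE !sum_ffunE mulr_sumr.
by apply: eq_bigr => x _; rewrite ffunE.
Qed.

Lemma cech_actA s1 s2 c : cech_act s1 (cech_act s2 c) = cech_act (s1 * s2) c.
Proof. by apply/ffunP => F; rewrite !ffunE tofracM mulrA. Qed.

Lemma cech_act1 c : cech_act 1 c = c.
Proof. by apply/ffunP => F; rewrite ffunE tofrac1 mul1r. Qed.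

Lemma cech_act0 c : cech_act 0 c = 0.
Proof. by apply/ffunP => F; rewrite !ffunE tofrac0 mul0r. Qed.

Lemma cech_actDl s1 s2 c : cech_act (s1 + s2) c = cech_act s1 c + cech_act s2 c.
Proof. by apply/ffunP => F; rewrite !ffunE tofracD mulrDl. Qed.

Lemma cech_actD s c e : cech_act s (c + e) = cech_act s c + cech_act s e.
Proof. by apply/ffunP => F; rewrite !ffunE mulrDr. Qed.

Lemma cech_actN1 c : cech_act (-1) c = - c.
Proof. by apply/ffunP => F; rewrite !ffunE tofracN tofrac1 mulN1r. Qed.

Lemma cech_cochain_diff J i c : is_ideal J -> cech_cochain J i c ->
  cech_cochain J i.+1 (cech_diff c).
Proof.
move=> iJ cJ G; rewrite ffunE; have [cG|cG] := eqVneq #|G| i.+1; last first.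
  apply: big1 => v vG; have := cJ (G :\ v).
  case: eqP => [e|_ ->]; last by rewrite mulr0.
  by case/eqP: cG; rewrite (cardsD1 v) vG e.
have loc v : v \in G -> loc_ideal J G (inc_sign K v G * c (G :\ v)).
  move=> vG; rewrite /inc_sign -(rmorph_sign tofrac); apply: loc_idealM => //.
  apply: (loc_ideal_sub iJ (subsetDl G [set v])).
  have := cJ (G :\ v); rewrite (_ : #|G :\ v| == i) //.
  by rewrite -eqSS -cG (cardsD1 v G) vG.
by apply: big_ind => //; [exact: loc_ideal0|move=> *; exact: loc_idealD].
Qed.

Lemma full_ideal : is_ideal (fun _ : S => True).
Proof. by []. Qed.

Variable I : S -> Prop.
Hypothesis iI : is_ideal I.

(** The cochains of degree [i - 1], none of them nonzero when [i = 0].  They make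
    the two cases in the definition of coboundaries one. *)
Definition cech_lower_cochain (i : nat) e : Prop :=
  forall F, if #|F|.+1 == i then loc_ideal (fun _ => True) F (e F) else e F = 0.

Lemma cech_coboundaryE i c : cech_coboundary I i c <->
  exists e, cech_lower_cochain i e /\ cech_cochain I i (c - cech_diff e).
Proof.
case: i => [|i] /=; last by split=> -[e [eC ce]]; exists e.
split=> [cI|[e [eC]]]; first by exists 0; split=> [F|]; rewrite ?ffunE // cech_diff0 subr0.
have -> : e = 0 by apply/ffunP => F; rewrite ffunE; exact: eC.
by rewrite cech_diff0 subr0.
Qed.

Lemma cech_lower_cochain_diff i e : cech_lower_cochain i e -> cech_cochain (fun _ =>
  True) i (cech_diff e).
Proof.
case: i => [|i] eC; last exact: cech_cochain_diff full_ideal eC.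
have -> : e = 0 by apply/ffunP => F; rewrite ffunE; exact: eC.
by rewrite cech_diff0; exact: cech_cochain0 full_ideal.
Qed.

Lemma cech_cochain_weak i c : cech_cochain I i c -> cech_cochain (fun _ => True) i c.
Proof. by move=> cI F; have := cI F; case: ifP => // _ [f [t [_ ->]]]; exists f, t. Qed.

Lemma coboundary_cocycle i c : cech_coboundary I i c -> cech_cocycle I i c.
Proof.
move/cech_coboundaryE => [e [eC ceI]]; split.
  rewrite -(subrK (cech_diff e) c); apply: cech_cochainD full_ideal _ _.
    exact: cech_cochain_weak.
  exact: cech_lower_cochain_diff.
have -> : cech_diff c = cech_diff (c - cech_diff e).
  by rewrite cech_diffD cech_diffN cech_diff_diff subr0.
exact: cech_cochain_diff.
Qed.

Lemma cocycle_submodule i : is_submodule (@cech_act k n) (cech_cocycle I i).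
Proof.
split.
- by split; rewrite ?cech_diff0; exact: cech_cochain0.
- move=> c e [c1 c2] [e1 e2]; split; first exact: cech_cochainD full_ideal _ _.
  by rewrite cech_diffD; exact: cech_cochainD.
- move=> s c [c1 c2]; split; first exact: cech_cochain_act full_ideal _.
  by rewrite cech_diff_act; exact: cech_cochain_act.
Qed.

Lemma coboundary_submodule i : is_submodule (@cech_act k n) (cech_coboundary I i).
Proof.
split.
- apply/cech_coboundaryE; exists 0; rewrite cech_diff0 subr0; split.
    by move=> F; rewrite ffunE; case: ifP => // _; exact: loc_ideal0 full_ideal.
  exact: cech_cochain0.
- move=> c c' /cech_coboundaryE[e [eC ce]] /cech_coboundaryE[e' [eC' ce']].
  apply/cech_coboundaryE; exists (e + e'); split.
    move=> F; have := eC F; have := eC' F; rewrite ffunE.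
    by case: ifP => _ => [? ?|-> ->]; [exact: loc_idealD full_ideal _ _|rewrite addr0].
  by rewrite cech_diffD opprD addrACA; exact: cech_cochainD.
- move=> s c /cech_coboundaryE[e [eC ce]]; apply/cech_coboundaryE; exists (cech_act s e);
  split.
    move=> F; have := eC F; rewrite ffunE.
    by case: ifP => _ => [?|->]; [exact: loc_idealM full_ideal _|rewrite mulr0].
  have -> : cech_act s c - cech_diff (cech_act s e) = cech_act s (c - cech_diff e).
    by rewrite cech_diff_act cech_actD -[- cech_diff e]cech_actN1 !cech_actA mulrC
      -cech_actA cech_actN1.
  exact: cech_cochain_act.
Qed.

End CechAlgebra.

Section Submodules.
Variables (k : fieldType) (n : nat).
Local Notation V := {ffun {set 'I_n} -> {fraction {mpoly k[n]}}}.
Variable (N : V -> Prop).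
Hypothesis sN : is_submodule (@cech_act k n) N.

Lemma submodule_opp c : N c -> N (- c).
Proof. by case: sN => _ _ mN /(mN (-1)); rewrite cech_actN1. Qed.

Lemma submodule_sum (T : Type) (r : seq T) (Q : pred T) (f : T -> V) :
  (forall x, Q x -> N (f x)) -> N (\sum_(x <- r | Q x) f x).
Proof. by case: sN => N0 aN _ Nf; elim/big_ind: _. Qed.
End Submodules.

(** * Graded pieces of the Cech complex *)

Section Laurent.
Variables (k : fieldType) (n : nat).
Local Notation S := {mpoly k[n]}.
Local Notation K := {fraction {mpoly k[n]}}.
Local Notation tofrac := (@FracField.tofrac {mpoly k[n]}).
Local Notation xT T := (set_expo [set: 'I_n] T).
Implicit Types (J : S -> Prop) (c e : {ffun {set 'I_n} -> K}) (F G H : {set 'I_n}) (s g : S)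
  (b : 'X_{1..n}) (T : nat).

(** Finitely many fractions can be given the common denominator
    (x_1 * ... * x_n)^T.  An exponent [b] of the numerator then stands for the
    integer degree [b - (T, ..., T)]. *)
Definition numerator T g (q : K) := tofrac g = tofrac 'X_[xT T] * q.

Lemma numerator0 T : numerator T 0 0.
Proof. by rewrite /numerator tofrac0 mulr0. Qed.

Lemma numeratorD T g g' q q' : numerator T g q -> numerator T g' q' ->
  numerator T (g + g') (q + q').
Proof. by rewrite /numerator tofracD mulrDr => -> ->. Qed.

Lemma numeratorB T g g' q q' : numerator T g q -> numerator T g' q' ->
  numerator T (g - g') (q - q').
Proof. by rewrite /numerator tofracB mulrBr => -> ->. Qed.

Lemma numeratorM T s g q : numerator T g q -> numerator T (s * g) (tofrac s * q).
Proof. by rewrite /numerator tofracM mulrCA => ->. Qed.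

Lemma numerator_sum T (A : Type) (r : seq A) (P : pred A) (f : A -> S) (q : A -> K) :
  (forall x, P x -> numerator T (f x) (q x)) ->
  numerator T (\sum_(x <- r | P x) f x) (\sum_(x <- r | P x) q x).
Proof.
move=> h; apply: (big_ind2 (numerator T)) => //; first exact: numerator0.
by move=> *; exact: numeratorD.
Qed.

Lemma numerator_eq0 T g q : numerator T g q -> (q == 0) = (g == 0).
Proof.
by move=> gq; rewrite -(tofrac_eq0 g) gq mulf_eq0 (negPf (tofracX_neq0 _ _)).
Qed.

Lemma numerator_frac T g : numerator T g (tofrac g / tofrac 'X_[xT T]).
Proof. by rewrite /numerator mulrC divfK // tofracX_neq0. Qed.

Lemma numerator_widen T T' g q : (T <= T')%N -> numerator T g q ->
  numerator T' ('X_[xT (T' - T)] * g) q.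
Proof.
move=> le gq; rewrite /numerator tofracM gq mulrA -tofracM -mpolyXD.
congr (tofrac 'X_[_] * _); apply/mnmP => i; by rewrite mnmDE !set_expoE in_setT subnK.
Qed.

Lemma loc_ideal_numerator J F q : loc_ideal J F q -> exists T g, numerator T g q.
Proof.
case=> f [t [_ ->]]; exists t, (f * 'X_[set_expo (~: F) t]).
rewrite /numerator mono_of_setX tofracM mulrCA; congr (_ * _).
apply: (mulIf (tofracX_neq0 k (set_expo F t))); rewrite mulfVK ?tofracX_neq0 //.
rewrite -tofracM -mpolyXD; congr (tofrac 'X_[_]); apply/mnmP => i.
by rewrite mnmDE !set_expoE in_setT in_setC; case: (i \in F); rewrite ?addn0.
Qed.

Lemma numerator_family (A : finType) (q : A -> K) :
  (forall x, exists T g, numerator T g (q x)) ->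
  exists T0, forall T, (T0 <= T)%N -> exists g : A -> S, forall x, numerator T (g x) (q x).
Proof.
move=> /choice[t tP]; exists (\max_x t x)%N => T le.
suff /choice[g gP] : forall x, exists g, numerator T g (q x) by exists g.
move=> x; have [g gq] := tP x; exists ('X_[xT (T - t x)] * g); apply: numerator_widen gq.
exact: leq_trans (leq_bigmax x) le.
Qed.

(** The set of the negative coordinates of the degree that [b] stands for.  The
    positive part of this degree is the truncated difference of [b] and
    [(T, ..., T)]. *)
Definition neg_support T b : {set 'I_n} := [set i | (b i < T)%N].

Lemma neg_supportP T b F :
  reflect (forall i, i \notin F -> (T <= b i)%N) (neg_support T b \subset F).
Proof.
apply: (iffP subsetP) => [h i iF|h i].
  by rewrite leqNgt; apply: contra iF => lt; apply: h; rewrite inE.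
by rewrite inE ltnNge; apply: contraR => /h.
Qed.

(** To reach a denominator that is a power of [x_F], the numerator must be
    divisible by the power [T] of each variable outside [F].  It lies in the
    extended ideal when its exponents outside [F] allow this, the exponents in
    [F] being adjustable by powers of [x_F]. *)
Lemma loc_idealP J M F T g q : upset M -> (forall f, J f <-> mon_ideal M f) ->
  numerator T g q ->
  loc_ideal J F q <-> forall b, b \in msupp g -> neg_support T b \subset F /\
     exists2 m : 'X_{1..n}, M m & forall i, i \notin F -> (m i <= b i - T)%N.
Proof.
move=> uM JM gq; split=> [[f [t [/JM Mf qE]]] b bg|h].
  have gf : g * 'X_[set_expo F t] = f * 'X_[xT T].
    apply/eqP; rewrite -tofrac_eq !tofracM gq qE mono_of_setX.
    by rewrite mulrA divfK ?tofracX_neq0 // mulrC.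
  have : (set_expo F t + b)%MM \in msupp (g * 'X_[set_expo F t]).
    by rewrite (perm_mem (msuppMX _ _)) map_f.
  rewrite gf (perm_mem (msuppMX _ _)) => /mapP[d df /mnmP e].
  have bE i : i \notin F -> b i = (T + d i)%N.
    by move=> /negPf iF; have := e i; rewrite !mnmDE !set_expoE iF in_setT.
  split; first by apply/neg_supportP => i /bE ->; rewrite leq_addr.
  by exists d; [exact: Mf|move=> i /bE ->; rewrite addKn].
have /choice[m mP] : forall b, exists m : 'X_{1..n}, b \in msupp g ->
    M m /\ forall i, i \notin F -> (m i <= b i - T)%N.
  move=> b; case: (boolP (b \in msupp g)) => [/h[_ [m Mm mb]]|_]; first by exists m.
  by exists b.
(* After multiplication by x_F^s the exponents in F are at least those of m b. *)
pose s := (\max_(b <- msupp g) mdeg (m b))%N.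
pose g' : S := \sum_(b <- msupp g) g@_b *: 'X_[(b + set_expo F (T + s) - xT T)%MM].
exists g', (T + s)%N; split.
  apply/JM; rewrite /g' big_seq; have iM := mon_ideal_ideal k uM.
  apply: ideal_sum => // b bg; have [Mm mb] := mP b bg.
  have MX : mon_ideal M ('X_[(b + set_expo F (T + s) - xT T)%MM] : S).
    apply/mon_idealX; apply: uM Mm _; apply/mnm_lepP => i.
    rewrite mnmBE mnmDE !set_expoE in_setT; case: (boolP (i \in F)) => iF; last first.
      by rewrite addn0; exact: mb.
    rewrite addnCA addKn; apply: leq_trans (leq_addl _ _).
    apply: leq_trans (_ : mdeg (m b) <= _)%N; first by rewrite mdegE (bigD1 i) //= leq_addr.
    by rewrite /s; exact: (leq_bigmax_seq (F := fun b => mdeg (m b))).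
  by case: iM => _ _ mM; rewrite -mul_mpolyC; exact: mM MX.
have g'E : g' * 'X_[xT T] = g * 'X_[set_expo F (T + s)].
  rewrite /g' mulr_suml [g in RHS]mpolyE mulr_suml big_seq [RHS]big_seq.
  apply: eq_bigr => b bg; rewrite -!scalerAl -!mpolyXD submK //.
  have [/neg_supportP nb _] := h b bg; apply/mnm_lepP => i.
  rewrite mnmDE !set_expoE in_setT; case: (boolP (i \in F)) => iF.
    by rewrite addnCA leq_addr.
  by rewrite addn0 nb.
rewrite mono_of_setX; apply: (mulfI (tofracX_neq0 k (xT T))); rewrite -gq mulrA.
apply: (mulIf (tofracX_neq0 k (set_expo F (T + s)))).
by rewrite divfK ?tofracX_neq0 // -!tofracM -g'E mulrC.
Qed.

Definition numerators T (g : {set 'I_n} -> S) c := forall F, numerator T (g F) (c F).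

Definition num_diff (g : {set 'I_n} -> S) G : S :=
  \sum_(v in G) inc_sign k v G *: g (G :\ v).

Lemma numerators_diff T (g : {set 'I_n} -> S) c : numerators T g c ->
  numerators T (num_diff g) (cech_diff c).
Proof.
move=> gc G; rewrite ffunE; apply: numerator_sum => v vG.
have -> : inc_sign K v G = tofrac (inc_sign k v G)%:MP.
  by rewrite /inc_sign rmorph_sign rmorph_sign.
by rewrite -mul_mpolyC; exact: numeratorM.
Qed.

Lemma mcoeff_num_diff (g : {set 'I_n} -> S) G b :
  (num_diff g G)@_b = codiff (fun H => (g H)@_b) G.
Proof. by rewrite raddf_sum; apply: eq_bigr => v _; rewrite /= mcoeffZ. Qed.

Lemma numerators_sub T (g g' : {set 'I_n} -> S) c c' : numerators T g c ->
  numerators T g' c' -> numerators T (fun F => g F - g' F) (c - c').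
Proof. by move=> gc gc' F; rewrite !ffunE; exact: numeratorB. Qed.

Lemma msupp_mulX s b (m : 'X_{1..n}) : (s * 'X_[m])@_b != 0 -> (m <= b)%MM.
Proof.
rewrite -mcoeff_msupp (perm_mem (msuppMX _ _)) => /mapP[d _ ->]; exact: lem_addr.
Qed.

Lemma cochain_slices J i T (g : {set 'I_n} -> S) c
    (Q : {set 'I_n} -> 'X_{1..n} -> Prop) :
  (forall F, loc_ideal J F (c F) <-> forall b, b \in msupp (g F) -> Q F b) ->
  numerators T g c ->
  cech_cochain J i c <-> forall F b, (g F)@_b != 0 -> #|F| = i /\ Q F b.
Proof.
move=> locQ gc; split=> [cJ F b|h F].
  have := cJ F; rewrite -mcoeff_msupp; case: eqP => [cF /locQ QF /QF //|_ /eqP].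
  by rewrite (numerator_eq0 (gc F)) => /eqP ->; rewrite msupp0.
case: (#|F| =P i) => cF.
  by apply/locQ => b; rewrite mcoeff_msupp => /h[].
apply/eqP; rewrite (numerator_eq0 (gc F)) -msupp_eq0; apply/eqP.
by case E : (msupp _) => [//|b r];
  have /h[] : (g F)@_b != 0 by rewrite -mcoeff_msupp E inE eqxx.
Qed.

Lemma loc_trueP F T g q : numerator T g q ->
  loc_ideal (fun _ => True) F q <-> forall b, b \in msupp g -> neg_support T b \subset F.
Proof.
move=> gq; rewrite (@loc_idealP _ (fun _ => True) F T g q) //.
by split=> h b /h; [case|split=> //; exists 0%MM => // i _; rewrite mnm0E].
Qed.

Lemma cech_true_slices i T (g : {set 'I_n} -> S) c : numerators T g c ->
  cech_cochain (fun _ => True) i c <->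
  forall F b, (g F)@_b != 0 -> #|F| = i /\ neg_support T b \subset F.
Proof. by move=> gc; apply: (cochain_slices i _ gc) => F; exact: loc_trueP. Qed.

Section Monomial.
Variable I : S -> Prop.
Hypothesis I_mon : monomial_ideal I.
Local Notation Del T b := (degree_complex I (b - xT T)%MM).

(** Takayama's formula at the level of cochains: in the degree of [b], the
    localization of [I] at [x_F] is all of the localization of [S] if [F] is not
    a face of the degree complex, and zero otherwise. *)
Lemma cech_ideal_slices i T (g : {set 'I_n} -> S) c : numerators T g c ->
  cech_cochain I i c <->
  forall F b, (g F)@_b != 0 -> #|F| = i /\ (neg_support T b \subset F /\ F \notin Del T b).
Proof.
move=> gc; have [uM IE] := monomial_idealP I_mon.
apply: (cochain_slices i _ gc) => F; rewrite (loc_idealP F uM IE (gc F)).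
split=> h b /h[nF].
  case=> m Im mb; split=> //; apply/degree_complexPn; exists m => // j /mb.
  by rewrite mnmBE set_expoE in_setT.
move/degree_complexPn => [m Im mb]; split=> //; exists m => // j /mb.
by rewrite mnmBE set_expoE in_setT.
Qed.

Lemma cocycle_slices i T (g : {set 'I_n} -> S) c b : numerators T g c ->
  cech_cocycle I i c ->
  let u H := (g H)@_b in
  (forall H, u H != 0 -> #|H| = i /\ neg_support T b \subset H) /\
  forall G, G \in Del T b -> neg_support T b \subset G -> #|G| = i.+1 -> codiff u G = 0.
Proof.
move=> gc [/(cech_true_slices i gc) h1 /(cech_ideal_slices i.+1 (numerators_diff gc)) h2] u.
split=> [H|G GD nG cG]; first exact: h1.
apply/eqP; apply: contraT; rewrite -mcoeff_num_diff => /h2[_ [_]].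
by rewrite GD.
Qed.

(** The Cech complex is the direct sum of its graded pieces, so a cochain is a
    coboundary when each of its finitely many nonzero pieces is. *)
Lemma sliced_coboundary i T (g : {set 'I_n} -> S) c : numerators T g c ->
  cech_cochain (fun _ => True) i c ->
  (forall b, exists w, (forall H, w H != 0 -> #|H|.+1 = i /\ neg_support T b \subset H) /\
     forall H, H \in Del T b -> neg_support T b \subset H -> #|H| = i ->
       (g H)@_b = codiff w H) ->
  cech_coboundary I i c.
Proof.
move=> gc /(cech_true_slices i gc) cT /choice[w wP].
pose r := undup (flatten [seq msupp (g F) | F : {set 'I_n}]).
have rP b F : (g F)@_b != 0 -> b \in r.
  move=> nz; rewrite mem_undup; apply/flatten_mapP; exists F; first by rewrite mem_enum.
  by rewrite mcoeff_msupp.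
pose ge H : S := \sum_(b <- r) w b H *: 'X_[b].
have geE H b : (ge H)@_b = if b \in r then w b H else 0.
  rewrite raddf_sum /=; under eq_bigr do rewrite mcoeffZ mcoeffX.
  case: ifP => br; last first.
    by rewrite big1_seq // => d /andP[_ dr]; case: eqP => [e|];
      [rewrite -e dr in br|rewrite mulr0].
  rewrite (bigD1_seq b) ?undup_uniq //= eqxx mulr1 big1 ?addr0 // => d /negPf ->.
  by rewrite mulr0.
pose e := [ffun H => tofrac (ge H) / tofrac 'X_[xT T]].
have re : numerators T ge e by move=> H; rewrite ffunE; exact: numerator_frac.
apply/cech_coboundaryE; exists e; split.
  move=> F; have [cF|cF] := eqVneq #|F|.+1 i.
    apply/(loc_trueP F (re F)) => b; rewrite mcoeff_msupp geE.
    by case: ifP => [_ /(wP b).1[]|]; rewrite ?eqxx.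
  rewrite ffunE (_ : ge F = 0) ?tofrac0 ?mul0r //; apply/mpolyP => b; rewrite mcoeff0 geE.
  case: ifP => // _; apply/eqP; apply: contraNT cF => /(wP b).1[-> _]; exact: eqxx.
apply/(cech_ideal_slices i (numerators_sub gc (numerators_diff re))) => F b.
rewrite mcoeffB mcoeff_num_diff => nz.
have cE : codiff (fun H => (ge H)@_b) F = if b \in r then codiff (w b) F else 0.
  case: ifP => br; first by apply: codiff_eq => v _; rewrite geE br.
  by apply: big1 => v _; rewrite geE br mulr0.
move: nz; rewrite cE; case: ifP => br nz; last first.
  by move: nz; rewrite subr0 => /rP; rewrite br.
have [cF nF] : #|F| = i /\ neg_support T b \subset F.
  have [g0|/cT //] := eqVneq (g F)@_b 0.
  move: nz; rewrite g0 sub0r oppr_eq0 => /codiff_neq0[v vF /(wP b).1[cF nF]].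
  by rewrite (cardsD1 v) vF add1n; split=> //; apply: subset_trans nF (subsetDl _ _).
split=> //; split=> //; apply: contra nz => FD.
by rewrite (proj2 (wP b) F) // subrr.
Qed.

End Monomial.
End Laurent.

(** * Finite length of local cohomology *)

Section FiniteLength.
Variables (k : fieldType) (n : nat).
Local Notation S := {mpoly k[n]}.
Local Notation K := {fraction {mpoly k[n]}}.
Local Notation tofrac := (@FracField.tofrac {mpoly k[n]}).
Local Notation xT T := (set_expo [set: 'I_n] T).
Variable I : S -> Prop.
Hypothesis I_mon : monomial_ideal I.
Let iI := monomial_ideal_ideal I_mon.
Implicit Types (F G H : {set 'I_n}) (a b : 'X_{1..n}).

Lemma degree_complex_cone a (j : 'I_n) G :
  (forall b, min_generator I b -> (b j <= a j)%N) ->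
  G \in degree_complex I a -> j |: G \in degree_complex I a.
Proof.
move=> ba; rewrite !inE => /asboolP Ga; apply/asboolP => b bmin.
have [i iG lt] := Ga b bmin; exists i => //; rewrite in_setU1 negb_or iG andbT.
by apply: contraTneq lt => ->; rewrite -leqNgt ba.
Qed.

Lemma min_generator_bounded : exists N, forall b, min_generator I b ->
  forall i, (b i < N)%N.
Proof.
by apply: antichain_bounded => b c [Ib _] [_ minc] bc; exact: minc.
Qed.

(** The coefficients in the degrees with [0 <= b j < N] for all [j], finite in
    number, determine a cocycle up to a coboundary: in the other degrees the
    cohomology vanishes, by hypothesis if the negative support is nonempty and
    by the cone argument otherwise.  The length of a chain of submodules is at
    most the number of these coefficients.  For, if one picks a cocycle
    that is new at each step of a longer chain, a nontrivial linear combination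
    of them has no coefficient in these degrees, hence is a coboundary; the
    last cocycle involved would then lie in the submodule below its step. *)
Lemma finite_length_of_cohom i :
  (forall a F, F != set0 -> cohom_zero k (degree_complex I a) F i) ->
  local_cohomology_finite_length I i.
Proof.
move=> coh; have [N NP] := min_generator_bounded.
pose Y := ({ffun 'I_n -> 'I_N} * {set 'I_n})%type.
exists #|{: Y}| => r Ns NsP Ns_lt.
have Nsub j : (j <= r)%N -> is_submodule (@cech_act k n) (Ns j) by case/NsP.
have Nmono j l : (j <= l)%N -> (l <= r)%N -> forall c, Ns j c -> Ns l c.
  move=> jl; rewrite -(subnK jl); elim: (l - j)%N => [|m IH] // mr c Nc.
  by have [/(_ c) sub _] := Ns_lt (m + j)%N mr; apply: sub; apply: IH => //; exact: ltnW.
rewrite leqNgt -[r]card_ord; apply/negP => Yr.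
have /choice[w wP] : forall j : 'I_r, exists c, Ns j.+1 c /\ ~ Ns j c.
  by move=> j; case: (Ns_lt j (ltn_ord j)) => _ [c]; exists c.
have wZ j : cech_cocycle I i (w j).
  have [_ _ NZ] := NsP _ (ltn_ord j); apply: NZ; exact: (wP j).1.
have wlau (x : 'I_r * {set 'I_n}) : exists T g, numerator T g (w x.1 x.2).
  have [/(_ x.2) wC _] := wZ x.1; move: wC; case: eqP => _;
    first exact: loc_ideal_numerator.
  by move=> ->; exists 0%N, 0; exact: numerator0.
have [T /(_ T (leqnn T))[g gP]] := numerator_family wlau.
pose deg (y : {ffun 'I_n -> 'I_N}) : 'X_{1..n} := [multinom (y i + T)%N | i < n].
have [l [[j0 lj0] l0]] := exists_linear_relation (fun (j : 'I_r) (y : Y) =>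
  (g (j, y.2))@_(deg y.1)) Yr.
pose z := \sum_j cech_act (l j)%:MP (w j).
have repz : numerators T (fun H => \sum_j (l j)%:MP * g (j, H)) z.
  move=> H; rewrite sum_ffunE; apply: numerator_sum => j _; rewrite ffunE.
  by apply: numeratorM; exact: (gP (j, H)).
have zZ : cech_cocycle I i z.
  apply: (submodule_sum (cocycle_submodule iI i)) => j _.
  by have [_ _ mZ] := cocycle_submodule iI i; exact: mZ.
have zB : cech_coboundary I i z.
  apply: (sliced_coboundary I_mon repz); first by case: zZ.
  move=> b; have [uP uco] := cocycle_slices I_mon b repz zZ.
  have [n0|n0] := eqVneq (neg_support T b) set0; last exact: (coh _ _ n0 _ uP uco).
  have [/forallP bN|] := boolP [forall j, (b j - T < N)%N]; last first.
    rewrite negb_forall => /existsP[j]; rewrite -leqNgt => Nb.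
    have cone : cohom_zero k (degree_complex I (b - xT T)%MM) (neg_support T b) i.
      apply: (@cohom_zero_cone _ _ _ _ _ j); first by rewrite n0 inE.
      move=> G GD _; apply: degree_complex_cone GD => m /NP/(_ j)/ltnW mN.
      by rewrite mnmBE set_expoE in_setT (leq_trans mN).
    exact: (cone _ uP uco).
  exists (fun _ => 0); split=> [H|H _ _ _]; first by rewrite eqxx.
  rewrite [RHS]big1 => [|v _]; last by rewrite mulr0.
  pose y := [ffun j => Ordinal (bN j)].
  have -> : b = deg y.
    apply/mnmP => j; rewrite mnmE ffunE /= subnK //.
    by have := in_set0 j; rewrite -n0 inE => /negbT; rewrite -leqNgt.
  rewrite raddf_sum /= -[RHS](l0 (y, H)); apply: eq_bigr => j _.
  by rewrite mcoeffCM.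
(* The last step at which the coboundary z involves a chosen cocycle. *)
pose jm := [arg max_(j > j0 | l j != 0) (j : nat)].
have [ljm jmax] : l jm != 0 /\ forall j, l j != 0 -> (j <= jm)%N.
  by rewrite /jm; case: arg_maxnP => // j lj jmx; split=> // j' /jmx.
have sjm := Nsub jm (ltnW (ltn_ord jm)); have [_ aN mN] := sjm.
apply: (proj2 (wP jm)).
have zE : z = cech_act (l jm)%:MP (w jm) + \sum_(j | j != jm) cech_act (l j)%:MP (w j).
  by rewrite /z (bigD1 jm).
suff h : Ns jm (cech_act (l jm)%:MP (w jm)).
  have := mN (l jm)^-1%:MP _ h; rewrite cech_actA -mpolyCM mulVf //.
  by rewrite mpolyC1 cech_act1.
have -> : cech_act (l jm)%:MP (w jm) = z - \sum_(j | j != jm) cech_act (l j)%:MP (w j).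
  by rewrite zE addrK.
apply: aN.
  by have [_ BN _] := NsP _ (ltnW (ltn_ord jm)); exact: BN.
apply: (submodule_opp sjm); apply: (submodule_sum sjm) => j jjm.
have [->|lj] := eqVneq (l j) 0.
  by rewrite mpolyC0 cech_act0; case: sjm.
apply: mN; apply: (Nmono j.+1) => //; last exact: (wP j).1.
  by rewrite ltn_neqAle jmax // andbT.
exact: ltnW.
Qed.

(** Let [u] represent a nonzero class on the faces that contain [F].  It gives a
    cocycle [z t] in the degree that is [- t] on [F] and [a] outside [F], for
    each [t > 0].  Multiplication by polynomials does not decrease degrees, so
    [z j.+1] is not in the submodule generated by [z 1, ..., z j] and the
    coboundaries, and these submodules form chains of any length. *)
Lemma cohom_of_finite_length i : local_cohomology_finite_length I i ->
  forall a F, F != set0 -> cohom_zero k (degree_complex I a) F i.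
Proof.
move=> [r0 fin] a F /set0Pn[v vF] u uP uco; apply: contrapT => nw.
(* The exponent which, for the denominator (x_1 ... x_n)^T, stands for the
   degree - t on F and a outside F. *)
pose be T t : 'X_{1..n} := [multinom (if i \in F then T - t else T + a i)%N | i < n].
pose z t : {ffun {set 'I_n} -> K} :=
  [ffun H => tofrac (u H *: 'X_[be t t]) / tofrac 'X_[xT t]].
have repz t T : (t <= T)%N -> numerators T (fun H => u H *: 'X_[be T t]) (z t).
  move=> tT H; have := numerator_widen tT (numerator_frac t (u H *: 'X_[be t t])).
  rewrite -scalerAr -mpolyXD ffunE.
  rewrite (_ : (_ + _)%MM = be T t) //; apply/mnmP => j;
    rewrite mnmDE set_expoE in_setT !mnmE.
  by case: ifP => _; rewrite ?subnn ?addn0 // addnA subnK.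
have neg_be T t : (0 < t)%N -> (t <= T)%N -> neg_support T (be T t) = F.
  move=> t0 tT; apply/setP => j; rewrite inE mnmE; case: ifP => _.
    by rewrite ltn_subrL t0 (leq_trans t0).
  by rewrite ltnNge leq_addr.
have Del_be T t G : F \subset G ->
    (G \in degree_complex I (be T t - xT T)%MM) = (G \in degree_complex I a).
  apply: degree_complex_eq_off => j /negPf jF.
  by rewrite mnmBE set_expoE in_setT mnmE jF addKn.
have uF H : u H != 0 -> F \subset H by case/uP.
have coefz (T t : nat) H b : (u H *: 'X_[be T t])@_b = if be T t == b then u H else 0.
  by rewrite mcoeffZ mcoeffX; case: eqP; rewrite ?mulr1 ?mulr0.
have zZ t : (0 < t)%N -> cech_cocycle I i (z t).
  move=> t0; have rz := repz t t (leqnn t); split.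
    apply/(cech_true_slices i rz) => H b; rewrite coefz.
    case: (be t t =P b) => [<- /uP[-> FH]|]; rewrite ?eqxx //.
    by rewrite neg_be.
  apply/(cech_ideal_slices I_mon i.+1 (numerators_diff rz)) => G b.
  rewrite mcoeff_num_diff.
  have -> : codiff (fun H => (u H *: 'X_[be t t])@_b) G =
    if be t t == b then codiff u G else 0.
    case: (be t t =P b) => e; first by apply: codiff_eq => x _; rewrite coefz e eqxx.
    by apply: big1 => x _; rewrite coefz; case: (be t t =P b) => // _; rewrite mulr0.
  case: (be t t =P b) => [<- nz|]; last by rewrite eqxx.
  have [x xG /uP[cG FG]] := codiff_neq0 nz.
  have FG' := subset_trans FG (subsetDl _ _).
  have cG' : #|G| = i.+1 by rewrite (cardsD1 x) xG cG.
  rewrite neg_be //; split=> //; split=> //; rewrite Del_be //.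
  by apply: contra nz => GD; rewrite uco.
have [Z0 aZ mZ] := cocycle_submodule iI i.
have sB := coboundary_submodule iI i; have [B0 aB mB] := sB.
(* Ns j is the sum of the coboundaries and of the span of z 1, ..., z j. *)
pose comb (s : nat -> S) j := \sum_(l < j) cech_act (s l) (z l.+1).
pose Ns j c := cech_cocycle I i c /\ exists s : nat ->
  S, cech_coboundary I i (c - comb s j).
suff : (r0.+1 <= r0)%N by rewrite ltnn.
apply: (fin r0.+1 Ns) => [j _|j _]; last first.
  split.
    move=> c [cZ [s sP]]; split=> //; exists (fun l => if (l < j)%N then s l else 0).
    rewrite /comb big_ord_recr /= ltnn cech_act0 addr0.
    by under eq_bigr => l _ do rewrite ltn_ord.
  exists (z j.+1); split.
    split; first exact: zZ.
    exists (fun l => if l == j then 1 else 0).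
    rewrite /comb big_ord_recr /= eqxx cech_act1 big1 ?add0r ?subrr // => l _.
    by rewrite (ltn_eqF (ltn_ord l)) cech_act0.
  case=> _ [s /cech_coboundaryE[e [eC ce]]].
  have elau H : exists T g, numerator T g (e H).
    have := eC H; case: eqP => _; first exact: loc_ideal_numerator.
    by move=> ->; exists 0%N, 0; exact: numerator0.
  have [T0 T0P] := numerator_family elau.
  pose T := maxn T0 j.+1; have jT : (j.+1 <= T)%N by rewrite leq_maxr.
  have [ge geP] := T0P T (leq_maxl _ _); have {}geP : numerators T ge e := geP.
  pose gz H : S := u H *: 'X_[be T j.+1] - \sum_(l < j) s l * (u H *: 'X_[be T l.+1]).
  have repc : numerators T gz (z j.+1 - comb s j).
    move=> H; rewrite !ffunE sum_ffunE; apply: numeratorB.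
      by have := repz _ _ jT H; rewrite ffunE.
    apply: numerator_sum => l _; rewrite ffunE; apply: numeratorM.
    by apply: repz; apply: leq_trans jT; rewrite ltnS ltnW.
  pose b := be T j.+1.
  have gzb H : (gz H)@_b = u H.
    rewrite mcoeffB coefz eqxx raddf_sum big1 ?subr0 // => l _ /=.
    rewrite -scalerAr mcoeffZ; apply/eqP; rewrite mulf_eq0; apply/orP; right.
    apply: contraT => /msupp_mulX/mnm_lepP/(_ v); rewrite !mnmE vF leqNgt.
    have lT : (l.+1 < T)%N by apply: leq_trans jT; rewrite ltnS.
    by rewrite (ltn_sub2l lT) ?ltnS //.
  move/(cech_ideal_slices I_mon i (numerators_sub repc (numerators_diff geP))): ce => ce.
  apply: nw; exists (fun H => (ge H)@_b); split.
    move=> H nz; have cH : #|H|.+1 = i.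
      have := eC H; case: eqP => // _ /eqP; rewrite (numerator_eq0 (geP H)) => /eqP g0.
      by rewrite g0 mcoeff0 eqxx in nz.
    split=> //; have := eC H; rewrite cH eqxx => /(loc_trueP H (geP H))/(_ b).
    by rewrite mcoeff_msupp neg_be //; apply.
  move=> H HD FH cH; apply/eqP; rewrite -subr_eq0; apply: contraT => nz.
  have := ce H b; rewrite mcoeffB mcoeff_num_diff gzb => /(_ nz)[_ [_]].
  by rewrite Del_be // HD.
split.
- split; first (split; first exact: Z0).
    exists (fun _ => 0); rewrite /comb big1 ?subr0 // => l _; exact: cech_act0.
  move=> c c' [cZ [s sP]] [cZ' [s' sP']]; split; first exact: aZ.
    exists (fun l => s l + s' l).
    rewrite (_ : comb _ _ = comb s j + comb s' j); last first.
      by rewrite /comb -big_split; apply: eq_bigr => l _; rewrite cech_actDl.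
    by rewrite opprD addrACA; exact: aB.
  move=> x c [cZ [s sP]]; split; first exact: mZ.
  exists (fun l => x * s l).
  rewrite (_ : comb _ _ = cech_act x (comb s j)); last first.
    by rewrite /comb cech_act_sum; apply: eq_bigr => l _; rewrite cech_actA.
  rewrite -cech_actN1 cech_actA mulrC -cech_actA -cech_actD cech_actN1.
  exact: mB.
- move=> c cB; split; first exact: coboundary_cocycle.
  by exists (fun _ => 0); rewrite /comb big1 ?subr0 // => l _; exact: cech_act0.
- by move=> c [].
Qed.

Lemma finite_lengthP i : local_cohomology_finite_length I i <->
  forall a F, F != set0 -> cohom_zero k (degree_complex I a) F i.
Proof. by split; [exact: cohom_of_finite_length|exact: finite_length_of_cohom]. Qed.

(** The maximum in the definition of [rho] exists by Dickson's lemma. *)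
Lemma min_generator_le_rho j b : min_generator I b -> (b j <= rho I j)%N.
Proof.
move=> bmin; rewrite /rho; case: pselect => [h|[]].
  by case: (cid h) => r rP /=; case: rP => _; apply.
have [N NP] := min_generator_bounded.
pose P r := `[< exists2 b : 'X_{1..n}, min_generator I b & b j = r >].
have P0 : exists r, P r by exists (b j); apply/asboolP; exists b.
have Pb r : P r -> (r <= N)%N by case/asboolP => c /NP/(_ j)/ltnW cN <-.
case: (ex_maxnP P0 Pb) => r /asboolP rP rmax; exists r; split=> // c cmin.
by apply: rmax; apply/asboolP; exists c.
Qed.

End FiniteLength.

(** * Generalized Cohen-Macaulay ideals and Buchsbaum degree complexes *)

Section Main.
Variables (k : fieldType) (n : nat) (I : {mpoly k[n]} -> Prop).
Hypothesis I_mon : monomial_ideal I.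
Hypothesis I_unmixed : unmixed I.
Implicit Types (F G H : {set 'I_n}) (a b : 'X_{1..n}).

Lemma generalized_CM_cohom : generalized_CM I <->
  forall a F i, F != set0 -> dim_quot_ge I i.+1 -> cohom_zero k (degree_complex I a) F i.
Proof.
split=> [gcm a F i F0 di|h i di]; first exact: ((finite_lengthP I_mon i).1 (gcm i di)).
by apply/(finite_lengthP I_mon) => a F F0; exact: h.
Qed.

Lemma degree_complex_pure a : pure_complex (degree_complex I a).
Proof. by move=> F G; exact: facet_card. Qed.

(** Since all facets have as many elements as the dimension of [S/I], the range of
    degrees is the same for the Buchsbaum property of each nonvoid degree
    complex and for the local cohomology. *)
Lemma dim_succ_degree_complex a F i : F \in degree_complex I a ->
  (i < dim_succ (degree_complex I a))%N <-> dim_quot_ge I i.+1.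
Proof.
move=> Fa; have [G Ga _] := facet_above Fa.
rewrite (@dim_succ_facets _ _ #|G|); first by rewrite (facet_dim I_mon I_unmixed _ Ga).
  by apply/set0Pn; exists F.
by move=> G' G'a; exact: facet_card G'a Ga.
Qed.

(** Purity holds for all degree complexes, so only the vanishing is a condition.
    The cases in which [F] is not a face, or has more than [i] elements, are
    vacuous. *)
Lemma buchsbaum_degree_complex a : buchsbaum k (degree_complex I a) <->
  forall F i, F != set0 -> dim_quot_ge I i.+1 -> cohom_zero k (degree_complex I a) F i.
Proof.
have cD := @degree_complex_complex k n I a.
split=> [[_ bu] F i F0 di|h].
  have [Fa|nFa] := boolP (F \in degree_complex I a); last first.
    move=> u uP uco; exists (fun _ => 0); split=> [H|H HD FH _]; first by rewrite eqxx.
    by case/negP: nFa; exact: cD HD FH.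
  have id := (dim_succ_degree_complex i Fa).2 di.
  have [lt|le] := ltnP i #|F|.
    move=> u uP uco; exists (fun _ => 0); split=> [H|H HD FH cH]; first by rewrite eqxx.
    by move: lt; rewrite -cH ltnNge subset_leq_card.
  by rewrite -(subnK le); apply/homology_zero_cohom => //; apply: bu => //; rewrite subnK.
split; first exact: degree_complex_pure.
move=> F Fa F0 m lt; apply/homology_zero_cohom => //.
by apply: h => //; exact/(dim_succ_degree_complex _ Fa).
Qed.

Lemma generalized_CM_buchsbaum : generalized_CM I <->
  forall a, buchsbaum k (degree_complex I a).
Proof.
rewrite generalized_CM_cohom; split=> h a.
  by apply/buchsbaum_degree_complex => F i; exact: h.
exact/buchsbaum_degree_complex.
Qed.

(** For given [F], exponents in [F] may be replaced by [0] as they have no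
    influence on the faces that contain [F], and an exponent [a j] with [j]
    outside [F] that reaches [rho I j] makes these faces a cone. *)
Lemma generalized_CM_buchsbaum_rho : generalized_CM I <->
  forall a, (forall j, (a j < maxn 1 (rho I j))%N) -> buchsbaum k (degree_complex I a).
Proof.
split=> [/generalized_CM_buchsbaum h a _ //|h]; apply/generalized_CM_cohom => a F i F0 di.
have [/existsP[j /andP[jF aj]]|] := boolP [exists j, (j \notin F) && (rho I j <= a j)%N].
  apply: (@cohom_zero_cone _ _ _ _ _ j jF) => G GD _; apply: degree_complex_cone GD =>
    b bmin.
  exact: leq_trans (min_generator_le_rho j bmin) aj.
rewrite negb_exists => /forallP aF.
pose a' : 'X_{1..n} := [multinom (if i \in F then 0 else a i)%N | i < n].
have a'off j : j \notin F -> a' j = a j by move=> /negPf jF; rewrite mnmE jF.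
have /buchsbaum_degree_complex/(_ F i F0 di) coh : buchsbaum k (degree_complex I a').
  apply: h => j; rewrite mnmE; case: ifP => jF; first by rewrite leq_maxl.
  have := aF j; rewrite jF /= -ltnNge => lt; apply: leq_trans lt _; exact: leq_maxr.
move=> u uP uco; have [|w [wP wE]] := coh u uP.
  by move=> G GD FG; apply: uco => //; rewrite -(degree_complex_eq_off I a'off FG).
exists w; split=> // H HD FH; apply: wE => //.
by rewrite (degree_complex_eq_off I a'off FH).
Qed.

End Main.

Theorem proposition3p1 (k : fieldType) (n : nat) (I : {mpoly k[n]} -> Prop)
    (Delta : {set {set 'I_n}})
    (I_monomial : monomial_ideal I)
    (I_unmixed : unmixed I)
    (Delta_complex : simplicial_complex Delta)
    (sqrt_I : forall f, radical I f <-> stanley_reisner Delta f) :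
  [/\ generalized_CM I <->
        (forall a : 'X_{1..n}, buchsbaum k (degree_complex I a)),
      generalized_CM I <->
        (forall a : 'X_{1..n}, (forall j, (a j < maxn 1 (rho I j))%N) ->
           buchsbaum k (degree_complex I a))
    & generalized_CM I <->
        (forall Gamma : {set {set 'I_n}},
           simplicial_complex Gamma -> Gamma \subset Delta ->
           facets Gamma \subset facets Delta ->
           ~ buchsbaum k Gamma ->
           forall a : 'X_{1..n}, ~ in_L Delta I Gamma a)].
Proof.
split; first exact: generalized_CM_buchsbaum.
  exact: generalized_CM_buchsbaum_rho.
rewrite (generalized_CM_buchsbaum I_monomial I_unmixed).
split=> [bu Gam cG sG fG nbu a|h a].
  by move/(in_L_degree_complex I_monomial I_unmixed Delta_complex sqrt_I _ cG fG) => e;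
    apply: nbu; rewrite e.
apply: contrapT => nbu.
have cD := @degree_complex_complex k n I a.
have fD : facets (degree_complex I a) \subset facets Delta.
  rewrite (facets_degree_complex I_monomial I_unmixed Delta_complex sqrt_I).
  by apply/subsetP => F; rewrite inE => /andP[].
have sD := degree_complex_sub Delta_complex sqrt_I a.
apply: (h _ cD sD fD nbu a).
exact/(in_L_degree_complex I_monomial I_unmixed Delta_complex sqrt_I _ cD fD).
Qed.
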